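(* Let $Z$ be a nonempty countable set and let $\phi$ be a random lattice field on $Z$, defined on a probability space $(\Omega,\mathcal{M},\mu)$ and closed under complex conjugation. Let $N\in\mathbb{N}_+$ and suppose $\phi$ is $\ell_p$-clustering up to order $2N$. Let $X\in L^2(\mu)$ be a complex random variable. Then, for every $n\in\mathbb{N}_+$ with $n\le N$: <ol> <li>If $p=1$, $$\Bigl[\sum_{x\in Z^n}\bigl|\kappa[X,\phi(x_1),\ldots,\phi(x_n)]\bigr|^2\Bigr]^{1/2}\le \sqrt{\operatorname{cov}(X^*,X)}\; M_{2n}(\phi;1)^n\, e^{n}\sqrt{(2n)!}.$$</li> <li>If $p=2$, $$\sup_{x'\in Z^n}\Bigl[\sum_{x\in Z^n}|\Phi_n(x',x)|\,\bigl|\kappa[X,\phi(x_1),\ldots,\phi(x_n)]\bigr|^2\Bigr]^{1/2}\le \sqrt{\operatorname{cov}(X^*,X)}\; M_{2n}(\phi;2)^{2n}\, e^{2n}(2n)!,$$ where $\Phi_n(x',x):=\mathbb{E}\bigl[{:}\phi(x'_1)^*\cdots\phi(x'_n)^*{:}\;{:}\phi(x_1)\cdots\phi(x_n){:}\bigr]$.</li> </ol> In particular, all the sums above are finite.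
   Context: A random lattice field on a countable set $Z$ is a family $(\phi(x))_{x\in Z}$ of complex random variables on a common probability space $(\Omega,\mathcal{M},\mu)$; $\mathbb{E}$ denotes expectation. The field is closed under complex conjugation if for every $x\in Z$ there is $x_*\in Z$ with $\phi(x)^*=\phi(x_* )$. $\kappa[Y_1,\ldots,Y_n]$ denotes the joint cumulant of the random variables $Y_1,\dots,Y_n$ (so $\kappa[Y]=\mathbb{E}[Y]$), and $\operatorname{cov}(X^*,X)=\kappa[X^*,X]=\mathbb{E}|X|^2-|\mathbb{E}X|^2$. For $1\le p<\infty$ and $n\ge 2$, the $\ell_p$-clustering norms are $\|\phi\|^{(n)}_p:=\sup_{x_0\in Z}\bigl[\sum_{x\in Z^{n-1}}|\kappa[\phi(x_0),\phi(x_1),\ldots,\phi(x_{n-1})]|^p\bigr]^{1/p}$, and $\|\phi\|^{(1)}_p:=\sup_{x_0\in Z}|\mathbb{E}[\phi(x_0)]|$; for $p=\infty$, $\|\phi\|^{(n)}_\infty:=\sup_{x\in Z^n}|\kappa[\phi(x_1),\ldots,\phi(x_n)]|$. The field is $\ell_p$-clustering up to order $m$ if all these cumulants exist and $\|\phi\|^{(n)}_p<\infty$ for all $1\le n\le m$. Set $M_N(\phi;p):=\max_{1\le n\le N}\bigl(\frac{1}{n!}\|\phi\|^{(n)}_p\bigr)^{1/n}$. Wick polynomials (with respect to $\mu$): for a finite sequence $I=(i_1,\dots,i_k)$ of random variables $y_{i_j}$ with $y^I:=y_{i_1}\cdots y_{i_k}$ (and $y^\emptyset=1$), having all needed moments finite,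 ${:}y^I{:}$ is defined recursively by ${:}y^\emptyset{:}=1$ and ${:}y^I{:}=y^I-\sum_{E\subsetneq I}\mathbb{E}[y^{I\setminus E}]\,{:}y^E{:}$, the sum running over proper subsequences $E$ of $I$. *)

(* Defs.v *)
From HB Require Import structures.
From mathcomp Require Import all_boot all_order all_algebra.
From mathcomp Require Import all_classical all_reals all_analysis.
From mathcomp Require Import complex.
Set Implicit Arguments. Unset Strict Implicit. Unset Printing Implicit Defensive.
Import Order.TTheory GRing.Theory Num.Theory.
Local Open Scope ring_scope.
Local Open Scope classical_set_scope.

Section Defs.
Variables (d : measure_display) (T : measurableType d) (R : realType).
Variable (mu : probability T R).

Local Notation C := (R[i]).

Definition crv := T -> C.

Definition cmod (z : C) : R := Num.sqrt (complex.Re z ^+ 2 + complex.Im z ^+ 2).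

Definition rvRe (f : crv) : T -> R := fun w => complex.Re (f w).
Definition rvIm (f : crv) : T -> R := fun w => complex.Im (f w).

Definition cintegrable (f : crv) : Prop :=
  mu.-integrable setT (EFin \o rvRe f) /\ mu.-integrable setT (EFin \o rvIm f).

Definition cexpect (f : crv) : C :=
  Complex (Rintegral mu setT (rvRe f)) (Rintegral mu setT (rvIm f)).

Definition rvprod (n : nat) (Y : 'I_n -> crv) (B : {set 'I_n}) : crv :=
  fun w => \prod_(i in B) Y i w.

Definition cumulant (n : nat) (Y : 'I_n -> crv) : C :=
  \sum_(P : {set {set 'I_n}} | finset.partition P [set: 'I_n])
     ((-1) ^+ (#|P|.-1) * (#|P|.-1)`!%:R) *
     \prod_(B in P) cexpect (rvprod Y B).

Definition rvcons (n : nat) (X : crv) (Y : 'I_n -> crv) : 'I_n.+1 -> crv :=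
  fun i => match unlift ord0 i with None => X | Some j => Y j end.

(** Wick polynomials :Y^A: (A a set of positions = a subsequence),
    defined by the recursion :y^A: = y^A - sum_{E proper subset of A}
    E[y^{A\E}] :y^E:, with fuel k >= #|A| *)
Fixpoint wick_aux (n : nat) (Y : 'I_n -> crv) (k : nat) (A : {set 'I_n}) : crv :=
  match k with
  | 0 => fun _ => 1
  | k'.+1 => fun w => rvprod Y A w -
      \sum_(E : {set 'I_n} | E \proper A)
         cexpect (rvprod Y (A :\: E)) * wick_aux Y k' E w
  end.

Definition wick (n : nat) (Y : 'I_n -> crv) : crv := wick_aux Y n [set: 'I_n].

Variable Z : countType.

Definition closed_under_conj (phi : Z -> crv) : Prop :=
  forall x : Z, exists xs : Z, forall w, conjc (phi x w) = phi xs w.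

(** all moments E[phi(x_1) ... phi(x_k)], k <= m, exist (so that all
    cumulants of order <= m exist) *)
Definition moments_upto (phi : Z -> crv) (m : nat) : Prop :=
  forall (k : nat) (x : 'I_k -> Z), (k <= m)%N ->
    cintegrable (rvprod (fun i => phi (x i)) [set: 'I_k]).

Definition clust_norm (phi : Z -> crv) (p : R) (n : nat) : \bar R :=
  match n with
  | 0 => 0%E
  | 1 => ereal_sup (range (fun x0 : Z => (cmod (cexpect (phi x0)))%:E))
  | k.+1 => ereal_sup (range (fun x0 : Z =>
      poweR (\esum_(x in [set: 'I_k -> Z])
               ((cmod (cumulant (rvcons (phi x0) (fun i => phi (x i))))) `^ p)%:E)
            p^-1))
  end.

Definition clustering_upto (phi : Z -> crv) (p : R) (m : nat) : Prop :=
  moments_upto phi m /\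
  forall n : nat, (1 <= n <= m)%N -> (clust_norm phi p n < +oo)%E.

Definition Mconst (phi : Z -> crv) (p : R) (N : nat) : R :=
  \big[Num.max/0]_(1 <= n < N.+1)
     ((fine (clust_norm phi p n) / n`!%:R) `^ (n%:R^-1)).

Definition L2 (X : crv) : Prop :=
  measurable_fun setT (rvRe X) /\ measurable_fun setT (rvIm X) /\
  mu.-integrable setT (EFin \o (fun w => cmod (X w) ^+ 2)).

Definition covXX (X : crv) : R :=
  Rintegral mu setT (fun w => cmod (X w) ^+ 2) - cmod (cexpect X) ^+ 2.

Definition PhiW (phi : Z -> crv) (n : nat) (x' x : 'I_n -> Z) : C :=
  cexpect (fun w => wick (fun i => fun w' => conjc (phi (x' i) w')) w *
                    wick (fun i => phi (x i)) w).

End Defs.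

(* Main.v *)
(** Moments, viewed as functions of the set of positions, are the convolution
    exponential of the cumulants, and Wick polynomials are obtained by dividing
    monomials by moments in this convolution algebra.  Hence kappa[X, phi_J] is
    E[(X - EX) :phi^J:], and Phi_n is the exponential of the cumulants of those
    sets of positions which meet both halves.  Its recursion formula bounds the
    row sums of |Phi_n|^p (p = 1, 2) by ((2n)! (2 M)^(2n))^p, which is enough
    since 2 <= e.  The theorem follows by duality: test X - EX against
    sum_x g(x) kappa_x^* :phi^x: with g = 1 or g = |Phi_n(x', .)|, apply
    Cauchy-Schwarz, and bound the resulting quadratic form in Phi_n by the Schur
    test (p = 1) or the Hilbert-Schmidt norm (p = 2). *)
Require Import Defs.
From HB Require Import structures.
From mathcomp Require Import all_boot all_order all_algebra.
From mathcomp Require Import boolp ring.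
Set Implicit Arguments. Unset Strict Implicit. Unset Printing Implicit Defensive.
Import Order.TTheory GRing.Theory Num.Theory.
Local Open Scope ring_scope.

(** * Set functions and their convolution *)

Section SetFunctions.
Variables (I : finType) (K : comNzRingType).
Implicit Types (f g h k l m q : {set I} -> K) (A B D E U : {set I}) (a : I).

(** Sums over partitions are awkward to multiply and to compare, so only [mobius_setexp] works with
    them in earnest. Elsewhere an exponential is known through the first-order equations of
    [is_setexp], and identities follow by uniqueness: convolving with a function equal to 1 at the
    empty set is injective. The same equations supply the recursion used for the estimates.

    The clustering norms fix one site and sum over the others. In Phi_n(x', x) the sum runs over x
    with x' fixed, so a cumulant of sites of x alone would offer no fixed site and its sum would not
    be controlled. Wick ordering removes exactly these blocks: each remaining one contains a site of
    x', which takes the role of x_0. Conjugates of field values are field values, so the blocks are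
    cumulants of the field itself.

    Duality gives S^2 <= V S B for the weighted sum S, and dividing by S presupposes that S is
    finite. All estimates are therefore made on finite boxes W^n, uniformly in W, and pass to Z^n
    only at the end. *)

Definition setconv f g : {set I} -> K :=
  fun A => \sum_(E : {set I} | E \subset A) f E * g (A :\: E).

(* The derivation d/da of the set function algebra, kept on sets containing a. *)
Definition marked a f : {set I} -> K := fun E => if a \in E then f E else 0.

(* f = exp k for the convolution product, characterised by d_a f = d_a k * f;
   the value of k at the empty set is irrelevant. *)
Definition is_setexp k f :=
  f finset.set0 = 1 /\ forall a, marked a f = setconv (marked a k) f.

Lemma setDDK A E : E \subset A -> A :\: (A :\: E) = E.
Proof. by move=> EA; rewrite setDDr finset.setDv finset.set0U; apply/setIidPr. Qed.

Lemma setUDK A E : E \subset A -> E :|: (A :\: E) = A.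
Proof. by move=> EA; rewrite setDE setUIr setUCr setIT; apply/setUidPr. Qed.

Lemma setconvC f g : setconv f g = setconv g f.
Proof.
apply/funext => A; rewrite /setconv.
rewrite (reindex_onto (fun E => A :\: E) (fun E => A :\: E)) /=; last first.
  by move=> E; apply: setDDK.
apply: eq_big => [E|E /andP[_ /eqP ->]]; last by rewrite mulrC.
rewrite subsetDl; apply/eqP/idP => [<-|]; [exact: subsetDl | exact: setDDK].
Qed.

Lemma sum_subset_subset A (F : {set I} -> {set I} -> K) :
  \sum_(E : {set I} | E \subset A) \sum_(D : {set I} | D \subset E) F D E =
  \sum_(D : {set I} | D \subset A) \sum_(U : {set I} | U \subset A :\: D)
     F D (D :|: U).
Proof.
rewrite (exchange_big_dep (fun D => D \subset A)) /=; last first.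
  by move=> E D EA DE; apply: subset_trans EA.
apply: eq_bigr => D DA.
rewrite (reindex_onto (fun U => D :|: U) (fun E => E :\: D)) /=; last first.
  by move=> E /andP[_]; apply: setUDK.
apply: eq_bigl => U; rewrite subUset DA subsetUl /= andbT subsetD.
rewrite setDUl finset.setDv finset.set0U; congr (_ && _).
by apply/eqP/setDidPl.
Qed.

Lemma setconvA f g h : setconv f (setconv g h) = setconv (setconv f g) h.
Proof.
apply/funext => A; rewrite /setconv.
under [RHS]eq_bigr do rewrite big_distrl.
rewrite /= [RHS](@sum_subset_subset A (fun D E => f D * g (E :\: D) * h (A :\: E))).
apply: eq_bigr => D _; rewrite big_distrr /=; apply: eq_bigr => U.
rewrite subsetD => /andP[_ /setDidPl UD].
by rewrite setDUl finset.setDv finset.set0U UD setDDl mulrA.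
Qed.

Lemma setconvDl f g h : setconv (fun A => f A + g A) h = fun A => setconv f h A + setconv g h A.
Proof. by apply/funext => A; rewrite -big_split; apply: eq_bigr => E _; rewrite mulrDl. Qed.

Lemma setconvBl f g h : setconv (fun A => f A - g A) h = fun A => setconv f h A - setconv g h A.
Proof. by apply/funext => A; rewrite -sumrB; apply: eq_bigr => E _; rewrite mulrBl. Qed.

Lemma setconv_set0 f g : setconv f g finset.set0 = f finset.set0 * g finset.set0.
Proof.
rewrite /setconv (bigD1 finset.set0) //= setD0 big1 ?addr0 // => E.
by rewrite subset0 => /andP[/eqP ->]; rewrite eqxx.
Qed.

Lemma setconv_last f g A :
  setconv f g A = f A * g finset.set0 + \sum_(E : {set I} | E \proper A) f E * g (A :\: E).
Proof.
rewrite /setconv (bigD1 A) //= finset.setDv; congr (_ + _).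
by apply: eq_bigl => E; rewrite properEneq andbC.
Qed.

Lemma setconv_first f g A :
  setconv f g A = f finset.set0 * g A + \sum_(E : {set I} | E \proper A) g E * f (A :\: E).
Proof. by rewrite setconvC setconv_last mulrC. Qed.

Lemma subset_ind (P : {set I} -> Prop) :
  (forall A, (forall E, E \proper A -> P E) -> P A) -> forall A, P A.
Proof.
move=> IH A; have [n] := ubnP #|A|; elim: n A => // n IHn A An.
by apply: IH => E /proper_card EA; apply: IHn; apply: leq_trans EA _.
Qed.

(** Convolution by such a [q] is unitriangular for inclusion, hence injective. All uniqueness
    arguments below rest on this. *)
Lemma setconv_eq0 f q : q finset.set0 = 1 -> (forall A, setconv f q A = 0) -> forall A, f A = 0.
Proof.
move=> q0 fq; apply: subset_ind => A IH.
move: (fq A); rewrite setconv_last q0 mulr1 big1 ?addr0 // => E EA.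
by rewrite IH ?mul0r.
Qed.

(** Leibniz rule: [a] lies in exactly one of [E] and [A :\: E]. *)
Lemma marked_conv a f g :
  marked a (setconv f g) = fun A => setconv (marked a f) g A + setconv f (marked a g) A.
Proof.
apply/funext => A; rewrite /marked /setconv -big_split /=.
case: ifPn => aA; last first.
  rewrite big1 // => E EA; rewrite (contraNF (subsetP EA a) aA) mul0r add0r.
  by rewrite inE (negPf aA) andbF /= mulr0.
apply: eq_bigr => E EA; rewrite inE aA andbT.
by case: (a \in E); rewrite ?mul0r ?mulr0 ?addr0 ?add0r.
Qed.

Lemma setexp_conv k l f g :
  is_setexp k f -> is_setexp l g -> is_setexp (fun A => k A + l A) (setconv f g).
Proof.
move=> [f0 fk] [g0 gl]; split=> [|a]; first by rewrite setconv_set0 f0 g0 mulr1.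
rewrite marked_conv fk gl.
have -> : marked a (fun A => k A + l A) = fun A => marked a k A + marked a l A.
  by apply/funext => A; rewrite /marked; case: ifP; rewrite ?addr0.
rewrite setconvDl; apply/funext => A; congr (_ + _); first by rewrite setconvA.
by rewrite setconvC -setconvA (setconvC g).
Qed.

(** The quotient of exponentials is the exponential of the difference. Expand d_a (g * q) by the
    Leibniz rule; the resulting equation is the desired one convolved with [q], which can be
    cancelled. *)
Lemma setexp_div k l f q g :
  is_setexp k f -> is_setexp l q -> setconv g q = f ->
  is_setexp (fun A => k A - l A) g.
Proof.
move=> [f0 fk] [q0 ql] gqf.
have g0 : g finset.set0 = 1 by rewrite -f0 -gqf setconv_set0 q0 mulr1.
split=> // a.
have -> : marked a (fun A => k A - l A) = fun A => marked a k A - marked a l A.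
  by apply/funext => A; rewrite /marked; case: ifP; rewrite ?subr0.
pose r A := marked a g A - setconv (fun A => marked a k A - marked a l A) g A.
suff r0 A : r A = 0 by apply/funext => A; apply/eqP; rewrite -subr_eq0 -/(r A) r0.
apply: (setconv_eq0 q0) => {}A; rewrite /r setconvBl -setconvA gqf setconvBl.
have := congr1 (@^~ A) (fk a); rewrite -gqf marked_conv ql /= => <-.
by rewrite (setconvA g) (setconvC g) -(setconvA (marked a l)) gqf; rewrite addrK subrr.
Qed.

(** Restriction to subsets of [J] respects convolution, because [A] lies in [J] exactly when both
    [E] and [A :\: E] do. *)
Lemma setexp_restrict k f (J : {set I}) : is_setexp k f ->
  is_setexp (fun A => if A \subset J then k A else 0)
            (fun A => if A \subset J then f A else 0).
Proof.
move=> [f0 fk]; split=> [|a]; first by rewrite finset.sub0set.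
apply/funext => A; rewrite /setconv {1}/marked; case: (boolP (A \subset J)) => AJ.
  have := congr1 (@^~ A) (fk a); rewrite /marked /= => ->.
  apply: eq_bigr => E EA; rewrite (subset_trans EA AJ).
  by rewrite (subset_trans _ AJ) // subsetDl.
rewrite if_same big1 // => E EA; rewrite /marked.
case: (boolP (E \subset J)) => EJ; last by rewrite if_same mul0r.
case: (boolP (A :\: E \subset J)) => DJ; last by rewrite mulr0.
by case/negP: AJ; rewrite -(setID A E) subUset DJ andbT (subset_trans _ EJ) // subsetIr.
Qed.

(** The equations determine each d_a k, since convolution by [f] is injective, and every nonempty
    set contains some [a]. *)
Lemma setexp_log_inj k l f :
  is_setexp k f -> is_setexp l f -> forall A, A != finset.set0 -> k A = l A.
Proof.
move=> [f0 fk] [_ fl] A /set0Pn[a aA].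
have := @setconv_eq0 (fun A => marked a k A - marked a l A) f f0.
rewrite setconvBl -fk -fl => /(_ (fun=> subrr _) A) /eqP.
by rewrite subr_eq0 /marked aA => /eqP.
Qed.

(** The logarithm of [m] for convolution; the coefficients are the Möbius function of the partition
    lattice. With moments for [m] it is the joint cumulant. *)
Definition mobius m A : K :=
  \sum_(P : {set {set I}} | finset.partition P A)
     ((-1) ^+ (#|P|.-1) * (#|P|.-1)`!%:R) * \prod_(B in P) m B.


Lemma big_partition_block A D (F : {set {set I}} -> K) :
  D != finset.set0 -> D \subset A ->
  \sum_(P : {set {set I}} | finset.partition P (A :\: D)) F P =
  \sum_(Q : {set {set I}} | finset.partition Q A && (D \in Q)) F (Q :\ D).
Proof.
move=> D0 DA; have nDP P : finset.partition P (A :\: D) -> D \notin P.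
  move=> hP; apply: contra D0 => DP; have := partitionS hP DP.
  by rewrite subsetD => /andP[_]; rewrite -setI_eq0 finset.setIid.
rewrite (reindex_onto (fun Q => Q :\ D) (fun P => D |: P)) /=; last first.
  by move=> P hP; rewrite setU1K // nDP.
apply: eq_bigl => Q; apply/andP/andP => [[hQ /eqP QE]|[hQ DQ]]; last first.
  by rewrite partitionD1 // setD1K.
have DQ : D \in Q by rewrite -QE setU11.
split=> //; have := partitionU1 hQ D0.
by rewrite setD1K // setUDK // disjoints_subset setCD subsetUr; apply.
Qed.

(** Moment-cumulant relation. Expanding the convolution gives partitions Q of A with a distinguished
    block D avoiding [a], weighted by the coefficient of Q without D. For a Q with j + 1 > 1 blocks
    there are j choices of D, and they cancel the term in which no block is distinguished. *)
Lemma mobius_setexp m : m finset.set0 = 1 -> is_setexp (mobius m) m.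
Proof.
move=> m0; split=> // a; apply/funext => A; rewrite {1}/marked.
case: ifPn => aA; last first.
  rewrite /setconv big1 // => E EA; rewrite /marked ifN ?mul0r //.
  by apply: contra aA; apply: (subsetP EA).
pose c (P : {set {set I}}) : K := (-1) ^+ #|P|.-1 * (#|P|.-1)`!%:R.
pose w (P : {set {set I}}) := \prod_(B in P) m B.
rewrite setconv_last m0 mulr1 {1}/marked aA.
(* Sum over the complement D of E instead: D is to become a block. *)
have -> : \sum_(E : {set I} | E \proper A) marked a (mobius m) E * m (A :\: E) =
   \sum_(D : {set I} | [&& D \subset A, D != finset.set0 & a \notin D])
      mobius m (A :\: D) * m D.
  rewrite /marked (reindex_onto (fun D => A :\: D) (fun E => A :\: E)) /=; last first.
    by move=> E /proper_sub; apply: setDDK.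
  rewrite (bigID (fun D : {set I} => a \in D)) /= big1 ?add0r; last first.
    by move=> D /andP[_ aD]; rewrite inE aD mul0r.
  apply: eq_big => D; last first.
    by move=> /andP[/andP[_ /eqP->] aD]; rewrite inE aD aA.
  rewrite andbA; congr (_ && _); apply/andP/andP => [[pD /eqP <-]|[DA D0]].
    split; first exact: subsetDl.
    by rewrite -subset0 subDset setU0; move: pD; rewrite properE => /andP[].
  rewrite setDDK // properE subsetDl /=; split=> //.
  apply: contra D0 => AD; rewrite -finset.subset0 -(finset.setDv A).
  by rewrite -{1}(setDDK DA) setDS.
have -> : \sum_(D : {set I} | [&& D \subset A, D != finset.set0 & a \notin D])
      mobius m (A :\: D) * m D =
   \sum_(D : {set I} | [&& D \subset A, D != finset.set0 & a \notin D])
   \sum_(Q : {set {set I}} | finset.partition Q A && (D \in Q)) c (Q :\ D) * w Q.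
  apply: eq_bigr => D /and3P[DA D0 aD].
  rewrite /mobius big_distrl /= big_partition_block //.
  apply: eq_bigr => Q /andP[_ DQ]; rewrite -[LHS]mulrA; congr (_ * _).
  by rewrite /w [RHS](big_setD1 D) //= mulrC.
rewrite (exchange_big_dep (fun Q => finset.partition Q A)) /=; last first.
  by move=> D Q _ /andP[].
rewrite /mobius -big_split /=.
(* The one-block partition yields [m A]; it admits no D, as its only block contains [a]. *)
rewrite (bigD1 [set A]) /=; last first.
  by rewrite /finset.partition cover1 eqxx trivIset1 inE eq_sym; apply/set0Pn; exists a.
rewrite cards1 fact0 mulr1 big_set1 mul1r big1 ?addr0; last first.
  move=> D /andP[/and3P[_ _ aD] /andP[_]]; rewrite inE => /eqP DA.
  by rewrite DA aA in aD.
rewrite big1 ?addr0 // => Q /andP[hQ QA].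
rewrite -/(w Q) -/(c Q).
have Aa := hQ; have aQ : a \in cover Q by rewrite (cover_partition hQ).
pose B0 := pblock Q a.
have B0Q : B0 \in Q by rewrite pblock_mem.
(* The admissible D are all blocks of Q except the one containing [a]. *)
transitivity (c Q * w Q + \sum_(D in Q :\ B0) c (Q :\ D) * w Q).
  congr (_ + _); apply: eq_bigl => D; rewrite !inE hQ /=.
  case DQ: (D \in Q); rewrite ?andbF //= !andbT (partitionS hQ DQ) (partition_neq0 hQ DQ) /=.
  congr negb; apply/idP/eqP => [aD|->]; last by rewrite mem_pblock.
  by rewrite /B0 (def_pblock (partition_trivIset hQ) DQ aD).
have cQ : #|Q| = #|Q :\ B0|.+1 by rewrite (cardsD1 B0) B0Q.
have Q1 : (0 < #|Q :\ B0|)%N.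
  rewrite card_gt0; apply: contra QA; rewrite setD_eq0 => QB.
  have QE : Q = [set B0] by apply/eqP; rewrite finset.eqEsubset QB sub1set.
  by rewrite QE -(cover1 B0) -QE (cover_partition hQ).
under eq_bigr => D.
  rewrite !inE => /andP[_ DQ].
  have -> : c (Q :\ D) = c (Q :\ B0).
    by rewrite /c; have := cardsD1 D Q; rewrite DQ cQ add1n => -[->].
  over.
rewrite sumr_const -mulr_natr.
suff -> : c Q * w Q + c (Q :\ B0) * w Q * #|Q :\ B0|%:R = 0 by [].
(* With j + 1 blocks: (-1)^j j! + j (-1)^(j-1) (j-1)! = 0. *)
rewrite /c cQ; case: #|Q :\ B0| Q1 => // j _ /=.
rewrite exprS factS natrM; ring.
Qed.

End SetFunctions.

(** * Transport along injections, and splitting off one element *)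

Section Reindexing.
Variables (K : comNzRingType).

Lemma big_subset_imset (I J : finType) (f : I -> J) (A : {set I}) (F : {set J} -> K) :
  injective f ->
  \sum_(E : {set J} | E \subset f @: A) F E =
  \sum_(E : {set I} | E \subset A) F (f @: E).
Proof.
move=> fI; have fK (E : {set I}) : f @^-1: (f @: E) = E.
  by apply/setP => i; rewrite inE mem_imset.
rewrite (reindex_onto (fun E : {set I} => f @: E) (fun E : {set J} => f @^-1: E)) /=.
  apply: eq_bigl => E; rewrite fK eqxx andbT.
  by apply/idP/idP => [/(preimsetS f)|/imsetS]; [rewrite !fK|exact].
move=> E /subsetP EA; apply/setP => j; apply/imsetP/idP => [[i]|jE].
  by rewrite inE => iE ->.
by have /imsetP[i _ ji] := EA _ jE; exists i; rewrite // inE -ji.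
Qed.

Lemma imset_setD (I J : finType) (f : I -> J) (A B : {set I}) : injective f ->
  f @: (A :\: B) = f @: A :\: f @: B.
Proof.
move=> fI; apply/setP => j; rewrite inE; apply/imsetP/andP => [[i]|[jB /imsetP[i iA ji]]].
  by rewrite inE => /andP[iB iA] ->; rewrite !mem_imset.
by exists i; rewrite // inE iA andbT; apply: contra jB => iB; rewrite ji mem_imset.
Qed.

Lemma big_subsetU1 (I : finType) (a : I) (S : {set I}) (F : {set I} -> K) :
  a \notin S ->
  \sum_(E : {set I} | E \subset a |: S) (if a \in E then F E else 0) =
  \sum_(E : {set I} | E \subset S) F (a |: E).
Proof.
move=> aS; rewrite -big_mkcondr /=.
rewrite (reindex_onto (fun E : {set I} => a |: E) (fun E => E :\ a)) /=; last first.
  by move=> E /andP[_ aE]; rewrite setD1K.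
apply: eq_bigl => E; rewrite setU11 andbT; apply/andP/idP => [[Ea /eqP aE]|ES].
  have aE' : a \notin E by rewrite -aE !inE eqxx.
  apply/subsetP => i iE; have := subsetP Ea i; rewrite !inE iE orbT => /(_ isT).
  by case: eqP => // ia; rewrite -ia iE in aE'.
rewrite setUS // setU1K //; apply: contra aS; exact: (subsetP ES).
Qed.

Lemma setexp_imset (I J : finType) (f : I -> J) (k m : {set J} -> K) :
  injective f -> is_setexp k m ->
  is_setexp (fun A : {set I} => k (f @: A)) (fun A : {set I} => m (f @: A)).
Proof.
move=> fI [m0 mk]; split=> [|a]; first by rewrite imset0.
apply/funext => A; have := congr1 (@^~ (f @: A)) (mk (f a)).
rewrite /marked mem_imset //= => ->; rewrite /setconv big_subset_imset //.
by apply: eq_bigr => E _; rewrite mem_imset // imset_setD.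
Qed.

(** Both sides are logarithms of the same set function, so uniqueness applies and no partition has
    to be transported along [f]. *)
Lemma mobius_imset (I J : finType) (f : I -> J) (m : {set J} -> K) (A : {set I}) :
  injective f -> m finset.set0 = 1 -> A != finset.set0 ->
  mobius (fun A : {set I} => m (f @: A)) A = mobius m (f @: A).
Proof.
move=> fI m0; apply: setexp_log_inj (setexp_imset fI (mobius_setexp m0)) A.
by apply: mobius_setexp; rewrite imset0.
Qed.

(** The equation for d_a read at [a |: S]: the sum is over the block containing [a]. *)
Lemma setexp_U1 (I : finType) (k m : {set I} -> K) (a : I) (S : {set I}) :
  is_setexp k m -> a \notin S ->
  m (a |: S) = \sum_(E : {set I} | E \subset S) k (a |: E) * m (S :\: E).
Proof.
move=> [_ mk] aS; have := congr1 (@^~ (a |: S)) (mk a).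
rewrite /marked setU11 /= => ->; rewrite /setconv /marked.
transitivity (\sum_(E : {set I} | E \subset a |: S)
    if a \in E then k E * m ((a |: S) :\: E) else 0).
  by apply: eq_bigr => E _; case: ifP; rewrite ?mul0r.
rewrite big_subsetU1 //; apply: eq_bigr => E ES; congr (_ * m _).
apply/setP => i; rewrite !inE; case: eqP => [->|//].
by rewrite (negPf aS) andbF.
Qed.

End Reindexing.

(** * Set functions on the positions of two monomials *)

Section TwoHalves.
Variables (K : comNzRingType) (I J : finType).
Implicit Types (S U D : {set I + J}).

Definition lpart S : {set I} := [set i | inl i \in S]%SET.
Definition rpart S : {set J} := [set j | inr j \in S]%SET.
Definition bisjoin (A : {set I}) (B : {set J}) : {set I + J} :=
  [set s | match s with inl i => i \in A | inr j => j \in B end]%SET.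

Lemma lpart_join A B : lpart (bisjoin A B) = A. Proof. by apply/setP => i; rewrite !inE. Qed.
Lemma rpart_join A B : rpart (bisjoin A B) = B. Proof. by apply/setP => i; rewrite !inE. Qed.
Lemma join_parts S : bisjoin (lpart S) (rpart S) = S.
Proof. by apply/setP => -[i|j]; rewrite !inE. Qed.
Lemma lpartD S U : lpart (S :\: U) = lpart S :\: lpart U.
Proof. by apply/setP => i; rewrite !inE. Qed.
Lemma rpartD S U : rpart (S :\: U) = rpart S :\: rpart U.
Proof. by apply/setP => i; rewrite !inE. Qed.

Lemma subset_parts S U : (S \subset U) = (lpart S \subset lpart U) && (rpart S \subset rpart U).
Proof.
apply/subsetP/andP => [SU|[/subsetP L /subsetP R] [i|j]].
- by split; apply/subsetP => i; rewrite !inE; apply: SU.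
- by have := L i; rewrite !inE.
- by have := R j; rewrite !inE.
Qed.

Lemma big_subset_join S (F : {set I + J} -> K) :
  \sum_(D : {set I + J} | D \subset S) F D =
  \sum_(A : {set I} | A \subset lpart S) \sum_(B : {set J} | B \subset rpart S)
    F (bisjoin A B).
Proof.
rewrite pair_big /=.
rewrite (reindex_onto (fun p => bisjoin p.1 p.2) (fun D => (lpart D, rpart D))) /=.
  apply: eq_bigl => -[A B] /=.
  by rewrite subset_parts lpart_join rpart_join eqxx andbT.
by move=> D _; rewrite join_parts.
Qed.

Definition crossing (k : {set I + J} -> K) : {set I + J} -> K :=
  fun E => if (lpart E != finset.set0) && (rpart E != finset.set0) then k E else 0.

(* m = exp k, so dividing by the moments of the two halves removes from k the
   sets contained in one half. *)
Lemma setexp_crossing (k m G : {set I + J} -> K) : is_setexp k m ->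
  (forall (A : {set I}) (B : {set J}), \sum_(E : {set I} | E \subset A) \sum_(F : {set J} | F \subset B)
      G (bisjoin E F) * (m (bisjoin (A :\: E) finset.set0) * m (bisjoin finset.set0 (B :\: F)))
      = m (bisjoin A B)) ->
  is_setexp (crossing k) G.
Proof.
move=> mk GE.
(* The divisor is the convolution of the restrictions of [m] to the two halves; its value at a set
   is the product of the moments of the two parts. *)
have k1 := setexp_restrict (bisjoin finset.setT finset.set0) mk.
have k2 := setexp_restrict (bisjoin finset.set0 finset.setT) mk.
have [] := setexp_div mk (setexp_conv k1 k2) (g := G).
  apply/funext => S; rewrite -[in RHS](join_parts S) -GE [LHS]big_subset_join.
  apply: eq_bigr => A AS; apply: eq_bigr => B BS; congr (_ * _).
  rewrite /setconv.
  set U := S :\: _.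
  rewrite big_subset_join.
  have -> : lpart S :\: A = lpart U by rewrite lpartD lpart_join.
  have -> : rpart S :\: B = rpart U by rewrite rpartD rpart_join.
  (* Only the splitting of [U] into its left and right parts has both factors supported in their
     halves. *)
  rewrite (bigD1 (lpart U)) //= [X in _ + X]big1 ?addr0; last first.
    move=> E /andP[EU EnU]; apply: big1 => F FU.
    rewrite [X in _ * X]ifN ?mulr0 // subset_parts lpartD !lpart_join negb_and.
    apply/orP; left; rewrite subset0 setD_eq0.
    by apply: contra EnU => UE; rewrite finset.eqEsubset EU.
  rewrite (bigD1 finset.set0) ?finset.sub0set //= [X in _ + X]big1 ?addr0; last first.
    move=> F /andP[FU Fn0].
    rewrite ifN ?mul0r // subset_parts !rpart_join negb_and subset0 Fn0.
    by rewrite orbT.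
  rewrite subset_parts !lpart_join !rpart_join subxx subsetT /=.
  rewrite ifT; last first.
    by rewrite subset_parts lpartD rpartD !lpart_join !rpart_join finset.setDv subxx subsetT.
  congr (_ * m _); rewrite -[U in RHS]join_parts.
  apply/setP => -[i|j]; rewrite !inE ?andbF //.
  by case: (inl i \in S); rewrite ?andbF // andbT; case: (i \in A).
(* Subtracting both restrictions from [k] leaves the sets meeting both halves. The empty set, which
   would be subtracted twice, does not contain [a]. *)
move=> G0 Ga; split=> // a; rewrite Ga; congr (setconv _ G).
apply/funext => E; rewrite /marked /crossing.
case: ifP => // aE; rewrite !subset_parts !lpart_join !rpart_join !subsetT !subset0 andbT /=.
case: eqP => [l0|_]; case: eqP => [r0|_] /=; rewrite ?addr0 ?add0r ?subr0 ?subrr //.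
by move: aE; rewrite -(join_parts E) l0 r0 inE; case: (a) => ?; rewrite inE.
Qed.

End TwoHalves.

(** * Bounds for exponentials of set functions *)

Section FiniteSums.
Variable K : numFieldType.

Lemma ler_sum_inj (X Y : finType) (h : X -> Y) (P : pred X) (Q : pred Y) (F : Y -> K) :
  {in P &, injective h} -> (forall x, P x -> Q (h x)) -> (forall y, 0 <= F y) ->
  \sum_(x | P x) F (h x) <= \sum_(y | Q y) F y.
Proof.
move=> hI hPQ F0.
rewrite -(big_imset F (A := P)) //= [leRHS](bigID (mem (h @: P))) /=.
apply: ler_wpDr; first exact: sumr_ge0.
rewrite le_eqVlt; apply/orP; left; apply/eqP; apply: eq_bigl => y.
by apply/idP/andP => [yP|[]//]; split=> //; case/imsetP: yP => x /hPQ Qx ->.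
Qed.

(** Cauchy-Schwarz with the bounds [a], [b] in place of norms, from 2ab fg <= b^2 f^2 + a^2 g^2.
    Avoiding square roots keeps it valid in any [numFieldType]: it serves both for moduli in [R[i]]
    and for real kernels. *)
Lemma sum_mul_le (X : finType) (P : pred X) (f g : X -> K) (a b : K) :
  (forall x, 0 <= f x) -> (forall x, 0 <= g x) -> 0 <= a -> 0 <= b ->
  \sum_(x | P x) f x ^+ 2 <= a ^+ 2 -> \sum_(x | P x) g x ^+ 2 <= b ^+ 2 ->
  \sum_(x | P x) f x * g x <= a * b.
Proof.
move=> f0 g0 a0 b0 fa gb.
have z (u : X -> K) : (forall x, 0 <= u x) -> \sum_(x | P x) u x ^+ 2 <= 0 ->
    forall x, P x -> u x = 0.
  move=> u0 us x Px.
  have /eqP : \sum_(x | P x) u x ^+ 2 = 0.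
    by apply/eqP; rewrite eq_le us sumr_ge0 // => *; rewrite exprn_ge0.
  rewrite psumr_eq0 => [/allP /(_ x)|*]; last by rewrite exprn_ge0.
  by rewrite mem_index_enum Px sqrf_eq0 => /(_ isT) /eqP.
move: (a0); rewrite le0r => /orP[/eqP a_eq0|a_gt0].
  rewrite a_eq0 expr0n in fa; rewrite a_eq0 mul0r big1 // => x Px.
  by rewrite (z f) ?mul0r.
move: (b0); rewrite le0r => /orP[/eqP b_eq0|b_gt0].
  rewrite b_eq0 expr0n in gb; rewrite b_eq0 mulr0 big1 // => x Px.
  by rewrite (z g) ?mulr0.
have ab0 : 0 < a * b by rewrite mulr_gt0.
rewrite -(ler_pM2l (mulr_gt0 (ltr0Sn K 1) ab0)).
apply: (@le_trans _ _ (\sum_(x | P x) (b ^+ 2 * f x ^+ 2 + a ^+ 2 * g x ^+ 2))).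
  rewrite big_distrr /=; apply: ler_sum => x _; rewrite -subr_ge0.
  have -> : b ^+ 2 * f x ^+ 2 + a ^+ 2 * g x ^+ 2 - 2 * (a * b) * (f x * g x) =
    (b * f x - a * g x) ^+ 2 by ring.
  by rewrite real_exprn_even_ge0 // realB // ger0_real // mulr_ge0.
rewrite big_split /= -!big_distrr /=.
have -> : 2 * (a * b) * (a * b) = b ^+ 2 * a ^+ 2 + a ^+ 2 * b ^+ 2 by ring.
by apply: lerD; apply: ler_wpM2l; rewrite ?exprn_ge0.
Qed.

(** The bound on the l^q norm, raised to the power q so that no root is taken in [K]. *)
Definition lq_le (X : finType) (q : nat) (P : pred X) (f : X -> K) (b : K) :=
  \sum_(x | P x) f x ^+ q <= b ^+ q.

Lemma lq_le_add (X : finType) q (P : pred X) (f g : X -> K) (a b : K) :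
  (q = 1 \/ q = 2)%N ->
  (forall x, 0 <= f x) -> (forall x, 0 <= g x) -> 0 <= a -> 0 <= b ->
  lq_le q P f a -> lq_le q P g b -> lq_le q P (fun x => f x + g x) (a + b).
Proof.
rewrite /lq_le => -[] -> f0 g0 a0 b0 fa gb; first by rewrite big_split lerD.
under eq_bigr do rewrite sqrrD.
rewrite !big_split /= sqrrD lerD // lerD //.
by rewrite mulr2n; apply: lerD; apply: sum_mul_le.
Qed.

Lemma lq_le_sum (X L : finType) q (P : pred X) (Q : pred L) (f : L -> X -> K) (b : L -> K) :
  (q = 1 \/ q = 2)%N ->
  (forall l x, 0 <= f l x) -> (forall l, 0 <= b l) ->
  (forall l, Q l -> lq_le q P (f l) (b l)) ->
  lq_le q P (fun x => \sum_(l | Q l) f l x) (\sum_(l | Q l) b l).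
Proof.
move=> q12 f0 b0 fb.
pose T (F : X -> K) (c : K) := [/\ forall x, 0 <= F x, 0 <= c & lq_le q P F c].
suff H (s : seq L) : T (fun x => \sum_(l <- s | Q l) f l x) (\sum_(l <- s | Q l) b l).
  by case: (H (index_enum L)).
elim: s => [|l s [F0 c0 IH]].
  split=> [x||]; rewrite ?big_nil // /lq_le big1 => [|x _]; rewrite ?exprn_ge0 //.
  by rewrite big_nil expr0n; case: q12 => ->.
split=> [x||]; first by apply: sumr_ge0.
  by apply: sumr_ge0.
have -> : (fun x => \sum_(l0 <- l :: s | Q l0) f l0 x) =
    fun x => (if Q l then f l x else 0) + \sum_(l0 <- s | Q l0) f l0 x.
  by apply/funext => x; rewrite big_cons; case: ifP; rewrite ?add0r.
rewrite big_cons; case: ifP => Ql.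
  by apply: lq_le_add => //; apply: fb.
by rewrite /lq_le /=; under eq_bigr do rewrite add0r.
Qed.

Lemma lq_le_trans (X : finType) q (P : pred X) (f g : X -> K) (a b : K) :
  (forall x, P x -> 0 <= f x <= g x) -> 0 <= a -> a <= b ->
  lq_le q P g a -> lq_le q P f b.
Proof.
move=> fg a0 ab ga; apply: le_trans (le_trans ga _); last first.
  by rewrite lerXn2r // nnegrE // (le_trans a0).
apply: ler_sum => x /fg /andP[f0 fgx].
by rewrite lerXn2r // nnegrE // (le_trans f0).
Qed.

Variables (J W : finType) (w0 : W).
Implicit Types (B : {set J}) (x : {ffun J -> W}).

(* The x with supp_in B x stand for W^B: coordinates outside B are frozen at w0. *)
Definition supp_in B x := [forall j, (j \notin B) ==> (x j == w0)].

Definition cut B x : {ffun J -> W} := [ffun j => if j \in B then x j else w0].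

Lemma supp_in_cut B x : supp_in B (cut B x).
Proof. by apply/forallP => j; apply/implyP => jB; rewrite ffunE ifN. Qed.

Lemma sum_supp_in_set0 (F : {ffun J -> W} -> K) :
  \sum_(x | supp_in finset.set0 x) F x = F [ffun=> w0].
Proof.
rewrite (big_pred1 [ffun=> w0]) // => x; apply/forallP/eqP => [h|-> j].
  by apply/ffunP => j; rewrite ffunE; have := h j; rewrite inE => /eqP.
by rewrite ffunE eqxx implybT.
Qed.

(** The pair of cuts determines a configuration supported in the union, so the sum on the left is
    part of the expanded product of the two sums. *)
Lemma lq_le_mul q B1 B2 (f g : {ffun J -> W} -> K) (a b : K) :
  (forall x, 0 <= f x) -> (forall x, 0 <= g x) -> 0 <= a -> 0 <= b ->
  (forall x, f (cut B1 x) = f x) -> (forall x, g (cut B2 x) = g x) ->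
  lq_le q (supp_in B1) f a -> lq_le q (supp_in B2) g b ->
  lq_le q (supp_in (B1 :|: B2)) (fun x => f x * g x) (a * b).
Proof.
move=> f0 g0 a0 b0 fE gE fa gb; rewrite /lq_le exprMn.
apply: (@le_trans _ _ ((\sum_(x | supp_in B1 x) f x ^+ q) * (\sum_(x | supp_in B2 x) g x ^+ q))).
  rewrite big_distrlr pair_big /=.
  pose h x := (cut B1 x, cut B2 x).
  pose F p := f p.1 ^+ q * g p.2 ^+ q.
  rewrite (eq_bigr (fun x => F (h x))) => [|x _]; last by rewrite /F /= fE gE exprMn.
  apply: ler_sum_inj => [x y xB yB [xy1 xy2]|x _|p].
  - apply/ffunP => j; move/ffunP/(_ j): xy1; move/ffunP/(_ j): xy2; rewrite !ffunE.
    have := forallP xB j; have := forallP yB j; rewrite !inE.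
    by case: (j \in B1); case: (j \in B2) => //= /eqP -> /eqP ->.
  - by rewrite !supp_in_cut.
  - by rewrite mulr_ge0 ?exprn_ge0.
apply: ler_pM => //; apply: sumr_ge0 => *; exact: exprn_ge0.
Qed.

End FiniteSums.

Lemma proper_setD (I : finType) (a : I) (S E : {set I}) :
  a \in S -> a \in E -> S :\: E \proper S.
Proof.
move=> aS aE; rewrite properE subsetDl; apply/subsetPn; exists a => //.
by rewrite inE aE.
Qed.

Lemma sum_subset_card (K : comNzRingType) (I : finType) (S : {set I}) (h : nat -> K) :
  \sum_(E : {set I} | E \subset S) h #|E| = \sum_(k < #|S|.+1) h k *+ 'C(#|S|, k).
Proof.
rewrite (partition_big (fun E : {set I} => inord #|E| : 'I_(#|S|.+1)) xpredT) //=.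
apply: eq_bigr => k _; rewrite -cards_draws -sumr_const.
apply: eq_big => [E|E /andP[ES /eqP <-]]; last by rewrite inordK // ltnS subset_leq_card.
rewrite inE; case ES: (E \subset S) => //=.
by rewrite -val_eqE /= inordK // ltnS subset_leq_card.
Qed.

(** Origin of the constant 2. The binomial cancels the factorials up to (k + 1) s! <= (s + 1)!, and
    the powers of 2 then form a geometric sum, which stays below 2^(s+1) whatever the number of
    terms. *)
Lemma fact_convolution_le s :
  (\sum_(k < s.+1) 'C(s, k) * (k.+1`! * ((s - k)`! * 2 ^ (s - k))) <= s.+1`! * 2 ^ s.+1)%N.
Proof.
have geo m : (\sum_(k < m) 2 ^ k < 2 ^ m)%N.
  elim: m => [|m IH]; first by rewrite big_ord0.
  by rewrite big_ord_recr /= expnS mul2n -addnn -addSn leq_add2r.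
apply: (@leq_trans (\sum_(k < s.+1) s.+1`! * 2 ^ (s - k))).
  apply: leq_sum => k _.
  have ks : (k <= s)%N by rewrite -ltnS.
  have -> : ('C(s, k) * (k.+1`! * ((s - k)`! * 2 ^ (s - k))) =
     k.+1 * s`! * 2 ^ (s - k))%N.
    by rewrite -(bin_fact ks) factS; ring.
  by rewrite factS leq_mul2r leq_mul2r ltn_ord !orbT.
rewrite -big_distrr leq_mul2l; apply/orP; right.
rewrite (reindex_inj rev_ord_inj) /= ltnW //.
rewrite (eq_bigr (fun k : 'I_(s.+1) => 2 ^ k)%N) ?geo // => k _.
by rewrite subSS subKn // -ltnS.
Qed.

(* I carries the fixed sites and J the summed ones; G_bound is an induction on #|S|
   using the recursion for a marked element, with fact_convolution_le as the count. *)
Section SetexpBound.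
Variables (K : numFieldType) (I J W : finType) (w0 : W) (q : nat) (M : K).
Hypotheses (q12 : (q = 1 \/ q = 2)%N) (M0 : 0 <= M).
Variables k G : {ffun J -> W} -> {set I + J} -> K.
Hypothesis Gexp : forall x, is_setexp (crossing (k x)) (G x).
Hypothesis k_local : forall (E : {set I + J}) (x y : {ffun J -> W}),
  (forall j, j \in rpart E -> x j = y j) -> k x E = k y E.
Hypothesis k_bound : forall E : {set I + J},
  lpart E != finset.set0 -> rpart E != finset.set0 ->
  lq_le q (supp_in w0 (rpart E)) (fun x => `|k x E|) (#|E|`!%:R * M ^+ #|E|).

Lemma G_rec x (S : {set I + J}) a : a \in S ->
  G x S = \sum_(E : {set I + J} | E \subset S)
             marked a (crossing (k x)) E * G x (S :\: E).
Proof. by move=> aS; have [_ /(_ a) /(congr1 (@^~ S))] := Gexp x; rewrite /marked aS. Qed.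

Lemma G_local (S : {set I + J}) (x y : {ffun J -> W}) :
  (forall j, j \in rpart S -> x j = y j) -> G x S = G y S.
Proof.
elim/subset_ind: S => S IH xy.
case: (set_0Vmem S) => [->|[a aS]].
  by have [-> _] := Gexp x; have [-> _] := Gexp y.
rewrite !(G_rec _ aS); apply: eq_bigr => E ES.
rewrite /marked; case: ifP => aE; last by rewrite !mul0r.
have pS := subset_parts E S; rewrite ES in pS; case/esym/andP: pS => _ /subsetP ESr.
congr (_ * _).
  by rewrite /crossing (k_local (y := y)) // => j /ESr /xy.
apply: IH => [|j]; last by rewrite rpartD inE => /andP[_ /xy].
exact: (proper_setD aS aE).
Qed.

Definition Gbound s : K := s`!%:R * 2 ^+ s * M ^+ s.

Lemma G_bound (S : {set I + J}) :
  lq_le q (supp_in w0 (rpart S)) (fun x => `|G x S|) (Gbound #|S|).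
Proof.
have Gb0 s : 0 <= Gbound s by rewrite /Gbound !mulr_ge0 ?exprn_ge0 ?ler0n.
elim/subset_ind: S => S IH.
case: (set_0Vmem S) => [->|[a aS]].
  have -> : rpart (I := I) (J := J) finset.set0 = finset.set0.
    by apply/setP => j; rewrite !inE.
  rewrite /lq_le sum_supp_in_set0; have [-> _] := Gexp [ffun=> w0].
  by rewrite /Gbound cards0 !expr0 fact0 !mulr1 normr1.
(* Bound for the summand of [G_rec] at E: hypothesis on the block E times induction on its
   complement. *)
pose b (E : {set I + J}) : K :=
  if a \in E then #|E|`!%:R * M ^+ #|E| * Gbound #|S :\: E| else 0.
have b0 E : 0 <= b E.
  by rewrite /b; case: ifP => // _; rewrite !mulr_ge0 ?exprn_ge0 ?ler0n.
(* Subsets containing [a] correspond to subsets of [S :\ a], and only cardinalities matter; once the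
   power of M is taken out, [fact_convolution_le] remains. *)
have bS : \sum_(E : {set I + J} | E \subset S) b E <= Gbound #|S|.
  rewrite -(setD1K aS) /b big_subsetU1 ?setD11 //.
  set S' := S :\ a.
  have aS' : a \notin S' by rewrite setD11.
  rewrite cardsU1 aS' add1n.
  rewrite (eq_bigr (fun E : {set I + J} =>
     (#|E|.+1`! * ((#|S'| - #|E|)`! * 2 ^ (#|S'| - #|E|)))%:R * M ^+ #|S'|.+1));
    last first.
    move=> E ES.
    have aE : a \notin E by apply: contra aS'; apply: (subsetP ES).
    have -> : S :\: (a |: E) = S' :\: E by rewrite /S' setDDl.
    rewrite cardsU1 aE add1n cardsD (setIidPr ES) /Gbound.
    have -> : M ^+ #|S'|.+1 = M ^+ #|E|.+1 * M ^+ (#|S'| - #|E|).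
      by rewrite -exprD addSn subnKC // subset_leq_card.
    rewrite !natrM natrX; ring.
  rewrite -big_distrl /=.
  rewrite (sum_subset_card S' (fun k => (k.+1`! * ((#|S'| - k)`! * 2 ^ (#|S'| - k)))%:R)).
  apply: ler_wpM2r; [exact: exprn_ge0 | rewrite -natrX -natrM].
  under eq_bigr do rewrite -mulrnA mulnC.
  by rewrite -natr_sum ler_nat fact_convolution_le.
apply: (lq_le_trans (g := fun x => \sum_(E : {set I + J} | E \subset S)
   `|marked a (crossing (k x)) E| * `|G x (S :\: E)|) _ _ bS).
- move=> x _; rewrite normr_ge0 (G_rec _ aS) /=.
  by apply: le_trans (ler_norm_sum _ _ _) _; apply: ler_sum => E _; rewrite normrM.
- exact: sumr_ge0.
apply: lq_le_sum => // [E x|E ES]; first by rewrite mulr_ge0.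
have pS := subset_parts E S; rewrite ES in pS; case/esym/andP: pS => _ ESr.
(* For the sets E that miss [a] or do not meet both halves. *)
have zero (c : K) : 0 <= c -> lq_le q (supp_in w0 (rpart S)) (fun=> 0 : K) c.
  move=> c0; rewrite /lq_le big1 ?exprn_ge0 // => *.
  by case: q12 => ->; rewrite expr0n.
rewrite /b /marked; case: ifP => aE; last first.
  by apply: (lq_le_trans _ _ _ (zero 0 (lexx 0))) => // x _; rewrite normr0 mul0r lexx.
have c0 : 0 <= #|E|`!%:R * M ^+ #|E| * Gbound #|S :\: E|.
  by rewrite !mulr_ge0 ?exprn_ge0 ?ler0n.
rewrite /crossing.
case: (boolP ((lpart E != finset.set0) && (rpart E != finset.set0))) => [/andP[El Er]|_];
  last first.
  by apply: (lq_le_trans _ _ _ (zero _ c0)) => // x _; rewrite normr0 mul0r lexx.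
(* The block depends only on the coordinates in [rpart E], the remaining factor only on those in
   [rpart (S :\: E)], so the two can be summed separately. *)
rewrite -[rpart S](setUDK ESr) -rpartD.
apply: lq_le_mul => //.
- by rewrite mulr_ge0 ?exprn_ge0 ?ler0n.
- by move=> x; congr `|_|; apply: k_local => j jE; rewrite ffunE jE.
- by move=> x; congr `|_|; apply: G_local => j jE; rewrite ffunE jE.
- exact: k_bound.
apply: IH.
exact: (proper_setD aS aE).
Qed.

End SetexpBound.

From mathcomp Require Import all_classical all_reals all_analysis.
From mathcomp Require Import measurable_realfun complex lra.
Local Open Scope classical_set_scope.

(** * Complex square integrable random variables *)

Section ComplexModulus.
Variable R : realType.
Implicit Types z : R[i].

Lemma cmod_ge0 z : 0 <= cmod z. Proof. exact: sqrtr_ge0. Qed.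

Lemma sqr_cmod z : cmod z ^+ 2 = complex.Re z ^+ 2 + complex.Im z ^+ 2.
Proof. by rewrite sqr_sqrtr // addr_ge0 ?sqr_ge0. Qed.

Lemma normc_cmod z : `|z| = (cmod z)%:C%C. Proof. exact: normc_def. Qed.

Lemma conjcM z1 z2 : conjc (z1 * z2) = conjc z1 * conjc z2.
Proof. exact: (rmorphM (@conjc R)). Qed.

Lemma conjc_sum (L : Type) (s : seq L) (P : pred L) (f : L -> R[i]) :
  conjc (\sum_(l <- s | P l) f l) = \sum_(l <- s | P l) conjc (f l).
Proof. exact: (rmorph_sum (@conjc R)). Qed.

Lemma real_complex_sum (L : Type) (s : seq L) (P : pred L) (f : L -> R) :
  ((\sum_(l <- s | P l) f l)%:C)%C = \sum_(l <- s | P l) ((f l)%:C)%C.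
Proof. exact: (rmorph_sum (real_complex R)). Qed.

Lemma real_complexX (r : R) (n : nat) : ((r ^+ n)%:C)%C = ((r%:C)%C) ^+ n.
Proof. exact: (rmorphXn (real_complex R)). Qed.

Lemma cmod_sum (L : Type) (s : seq L) (P : pred L) (f : L -> R[i]) :
  cmod (\sum_(l <- s | P l) f l) <= \sum_(l <- s | P l) cmod (f l).
Proof.
rewrite -lecR -normc_cmod real_complex_sum.
rewrite [leRHS](eq_bigr (fun l => `|f l|)) ?ler_norm_sum // => l _.
exact/esym/normc_cmod.
Qed.

Lemma cmod_conjc z : cmod (conjc z) = cmod z.
Proof. by case: z => a b; rewrite /cmod /= sqrrN. Qed.

Lemma cmodM z1 z2 : cmod (z1 * z2) = cmod z1 * cmod z2.
Proof. by apply: (@complexI R); rewrite -normc_cmod normrM !normc_cmod rmorphM. Qed.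

Lemma cmod_real (r : R) : 0 <= r -> cmod (r%:C)%C = r.
Proof. by move=> r0; apply: (@complexI R); rewrite -normc_cmod ger0_norm // ler0c. Qed.

Lemma conjc_mulC z : conjc z * z = ((cmod z ^+ 2)%:C)%C.
Proof. by rewrite rmorphXn /= -normc_cmod sqr_normc mulrC. Qed.

Lemma ReD z1 z2 : complex.Re (z1 + z2) = complex.Re z1 + complex.Re z2.
Proof. by case: z1; case: z2. Qed.
Lemma ImD z1 z2 : complex.Im (z1 + z2) = complex.Im z1 + complex.Im z2.
Proof. by case: z1; case: z2. Qed.
Lemma ReM z1 z2 : complex.Re (z1 * z2) =
  complex.Re z1 * complex.Re z2 - complex.Im z1 * complex.Im z2.
Proof. by case: z1; case: z2. Qed.
Lemma ImM z1 z2 : complex.Im (z1 * z2) =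
  complex.Re z1 * complex.Im z2 + complex.Im z1 * complex.Re z2.
Proof. by case: z1; case: z2. Qed.

Lemma normr_Re_le z : `|complex.Re z| <= cmod z.
Proof. by rewrite -lecR -normc_cmod normc_ge_Re. Qed.

Lemma normr_Im_le z : `|complex.Im z| <= cmod z.
Proof. by rewrite /cmod -sqrtr_sqr ler_wsqrtr // lerDr sqr_ge0. Qed.

End ComplexModulus.

Section Expectation.
Variables (d : measure_display) (T : measurableType d) (R : realType).
Variable (mu : probability T R).
Implicit Types f g : crv T R.

Lemma cintegrableD f g : cintegrable mu f -> cintegrable mu g ->
  cintegrable mu (fun w => f w + g w).
Proof.
move=> [fr fi] [gr gi]; split.
  apply: eq_integrable (integrableD _ fr gr) => // w _ /=.
  by rewrite /rvRe ReD EFinD.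
apply: eq_integrable (integrableD _ fi gi) => // w _ /=.
by rewrite /rvIm ImD EFinD.
Qed.

Lemma cexpectD f g : cintegrable mu f -> cintegrable mu g ->
  cexpect mu (fun w => f w + g w) = cexpect mu f + cexpect mu g.
Proof.
move=> [fr fi] [gr gi]; rewrite /cexpect /rvRe /rvIm.
apply/eqP; rewrite eq_complex /=; apply/andP; split; apply/eqP.
  by under eq_Rintegral do rewrite ReD; rewrite RintegralD.
by under eq_Rintegral do rewrite ImD; rewrite RintegralD.
Qed.

Lemma cintegrableZ (c : R[i]) f : cintegrable mu f -> cintegrable mu (fun w => c * f w).
Proof.
move=> [fr fi]; split.
  apply: eq_integrable (integrableB _ (integrableZl _ (complex.Re c) fr)
     (integrableZl _ (complex.Im c) fi)) => // w _ /=.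
  by rewrite /rvRe ReM EFinB !EFinM.
apply: eq_integrable (integrableD _ (integrableZl _ (complex.Re c) fi)
   (integrableZl _ (complex.Im c) fr)) => // w _ /=.
by rewrite /rvIm ImM EFinD !EFinM.
Qed.

Lemma cexpectZ (c : R[i]) f : cintegrable mu f ->
  cexpect mu (fun w => c * f w) = c * cexpect mu f.
Proof.
move=> [fr fi]; rewrite /cexpect /rvRe /rvIm.
have Zr (r : R) (u : T -> R) : mu.-integrable setT (EFin \o u) ->
    mu.-integrable setT (EFin \o (fun w => r * u w)).
  by move=> iu; apply: eq_integrable (integrableZl _ r iu).
apply/eqP; rewrite eq_complex ReM ImM /=; apply/andP; split; apply/eqP.
  under eq_Rintegral do rewrite ReM.
  by rewrite RintegralB ?RintegralZl //; apply: Zr.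
under eq_Rintegral do rewrite ImM.
by rewrite RintegralD ?RintegralZl //; apply: Zr.
Qed.

Lemma cintegrable0 : cintegrable mu (fun=> 0).
Proof. by split; apply: eq_integrable (integrable0 _ _). Qed.

Lemma fun_big_nil (L : Type) (P : pred L) (f : L -> crv T R) :
  (fun w => \sum_(l <- [::] | P l) f l w) = fun=> 0.
Proof. by apply/funext => w; rewrite big_nil. Qed.

Lemma fun_big_cons (L : Type) (l : L) (s : seq L) (P : pred L) (f : L -> crv T R) :
  (fun w => \sum_(l' <- l :: s | P l') f l' w) =
  if P l then fun w => f l w + \sum_(l' <- s | P l') f l' w
  else fun w => \sum_(l' <- s | P l') f l' w.
Proof. by apply/funext => w; rewrite big_cons; case: ifP. Qed.

Lemma cintegrable_sum (L : Type) (s : seq L) (P : pred L) (f : L -> crv T R) :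
  (forall l, P l -> cintegrable mu (f l)) ->
  cintegrable mu (fun w => \sum_(l <- s | P l) f l w).
Proof.
move=> fi; elim: s => [|l s IH].
  by rewrite fun_big_nil; exact: cintegrable0.
rewrite fun_big_cons.
by case: ifP => // Pl; apply: cintegrableD => //; apply: fi.
Qed.

Lemma cexpect0 : cexpect mu (fun=> 0) = 0.
Proof.
by rewrite /cexpect /rvRe /rvIm /= Rintegral_cst // mul0r.
Qed.

Lemma cexpect_sum (L : Type) (s : seq L) (P : pred L) (f : L -> crv T R) :
  (forall l, P l -> cintegrable mu (f l)) ->
  cexpect mu (fun w => \sum_(l <- s | P l) f l w) = \sum_(l <- s | P l) cexpect mu (f l).
Proof.
move=> fi; elim: s => [|l s IH].
  by rewrite fun_big_nil cexpect0 big_nil.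
rewrite fun_big_cons.
rewrite big_cons; case: ifP => // Pl.
by rewrite cexpectD ?IH //; [exact: fi|exact: cintegrable_sum].
Qed.

Lemma cexpect1 : cexpect mu (fun=> 1) = 1.
Proof.
rewrite /cexpect /rvRe /rvIm /= !Rintegral_cst //.
have -> : fine (mu setT) = 1 by rewrite probability_setT. 
by rewrite mul1r mul0r.

Qed.

Lemma measurable_sqr_cmod f :
  measurable_fun setT (rvRe f) -> measurable_fun setT (rvIm f) ->
  measurable_fun setT (fun w => cmod (f w) ^+ 2).
Proof.
move=> mr mi; apply: (eq_measurable_fun (fun w => rvRe f w ^+ 2 + rvIm f w ^+ 2)).
  by move=> w _; rewrite sqr_cmod.
by apply: measurable_funD; apply: measurable_funX.
Qed.

Lemma measurable_ReM f g :
  measurable_fun setT (rvRe f) -> measurable_fun setT (rvIm f) ->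
  measurable_fun setT (rvRe g) -> measurable_fun setT (rvIm g) ->
  measurable_fun setT (rvRe (fun w => f w * g w)).
Proof.
move=> fr fi gr gi.
apply: (eq_measurable_fun (fun w => rvRe f w * rvRe g w - rvIm f w * rvIm g w)).
  by move=> w _; rewrite /rvRe ReM.
by apply: measurable_funB; apply: measurable_funM.
Qed.

Lemma measurable_ImM f g :
  measurable_fun setT (rvRe f) -> measurable_fun setT (rvIm f) ->
  measurable_fun setT (rvRe g) -> measurable_fun setT (rvIm g) ->
  measurable_fun setT (rvIm (fun w => f w * g w)).
Proof.
move=> fr fi gr gi.
apply: (eq_measurable_fun (fun w => rvRe f w * rvIm g w + rvIm f w * rvRe g w)).
  by move=> w _; rewrite /rvIm ImM.
by apply: measurable_funD; apply: measurable_funM.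
Qed.

Lemma le_integrable_real (u v : T -> R) : measurable_fun setT u ->
  (forall w, `|u w| <= v w) -> mu.-integrable setT (EFin \o v) ->
  mu.-integrable setT (EFin \o u).
Proof.
move=> mu_ uv; apply: le_integrable => //; first exact/measurable_EFinP.
by move=> w _ /=; rewrite lee_fin (le_trans (uv w)) // ler_norm.
Qed.

Lemma L2_mul f g : L2 mu f -> L2 mu g ->
  cintegrable mu (fun w => f w * g w).
Proof.
move=> [fr [fi f2]] [gr [gi g2]].
have fg2 : mu.-integrable setT
    (EFin \o (fun w => cmod (f w) ^+ 2 + cmod (g w) ^+ 2)).
  by apply: eq_integrable (integrableD _ f2 g2).
have fg w : cmod (f w * g w) <= cmod (f w) ^+ 2 + cmod (g w) ^+ 2.
  rewrite cmodM; have := cmod_ge0 (f w); have := cmod_ge0 (g w).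
  move: (cmod (f w)) (cmod (g w)) => a b b0 a0; nra.
split; apply: le_integrable_real fg2.
- exact: measurable_ReM.
- by move=> w; apply: le_trans (fg w); apply: normr_Re_le.
- exact: measurable_ImM.
- by move=> w; apply: le_trans (fg w); apply: normr_Im_le.
Qed.

Lemma L2D f g : L2 mu f -> L2 mu g ->
  L2 mu (fun w => f w + g w).
Proof.
move=> [fr [fi f2]] [gr [gi g2]].
have mr : measurable_fun setT (rvRe (fun w => f w + g w)).
  apply: (eq_measurable_fun (fun w => rvRe f w + rvRe g w)).
    by move=> w _; rewrite /rvRe ReD.
  exact: measurable_funD.
have mi : measurable_fun setT (rvIm (fun w => f w + g w)).
  apply: (eq_measurable_fun (fun w => rvIm f w + rvIm g w)).
    by move=> w _; rewrite /rvIm ImD.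
  exact: measurable_funD.
split=> //; split=> //.
have fg2 : mu.-integrable setT
    (EFin \o (fun w => 2 * (cmod (f w) ^+ 2 + cmod (g w) ^+ 2))).
  by apply: eq_integrable (integrableZl _ 2 (integrableD _ f2 g2)).
apply: le_integrable_real fg2; first exact: measurable_sqr_cmod.
move=> w; rewrite ger0_norm ?sqr_ge0 // !sqr_cmod ReD ImD.
move: (complex.Re (f w)) (complex.Im (f w)) (complex.Re (g w)) (complex.Im (g w)).
move=> a b c e; have := sqr_ge0 (a - c); have := sqr_ge0 (b - e); nra.
Qed.

Lemma L2_cst (c : R[i]) : L2 mu (fun=> c).
Proof.
split; [exact: measurable_cst | split; first exact: measurable_cst].
exact: (@finite_measure_integrable_cst _ _ _ mu setT (cmod c ^+ 2)).
Qed.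

Lemma L2Z (c : R[i]) f : L2 mu f -> L2 mu (fun w => c * f w).
Proof.
move=> [fr [fi f2]]; split; [|split].
- by apply: (measurable_ReM (f := fun=> c)) => //; exact: measurable_cst.
- by apply: (measurable_ImM (f := fun=> c)) => //; exact: measurable_cst.
apply: eq_integrable (integrableZl _ (cmod c ^+ 2) f2) => // w _ /=.
by rewrite cmodM exprMn EFinM.
Qed.

Lemma L2_sum (L : Type) (s : seq L) (P : pred L) (f : L -> crv T R) :
  (forall l, P l -> L2 mu (f l)) ->
  L2 mu (fun w => \sum_(l <- s | P l) f l w).
Proof.
move=> fi; elim: s => [|l s IH].
  by rewrite fun_big_nil; exact: L2_cst.
rewrite fun_big_cons.
by case: ifP => // Pl; apply: L2D => //; apply: fi.
Qed.

Lemma L2_conj f : L2 mu f -> L2 mu (fun w => conjc (f w)).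
Proof.
move=> [fr [fi f2]]; split; [|split].
- by apply: eq_measurable_fun fr => w _; rewrite /rvRe; case: (f w).
- apply: (eq_measurable_fun (fun w => - rvIm f w)); last exact: measurableT_comp.
  by move=> w _; rewrite /rvIm; case: (f w).
by apply: eq_integrable f2 => // w _ /=; rewrite cmod_conjc.
Qed.

Lemma L2_cintegrable f : L2 mu f -> cintegrable mu f.
Proof.
move=> f2; have := L2_mul (L2_cst 1) f2.
by have -> : (fun w => 1 * f w) = f by apply/funext => w; rewrite mul1r.
Qed.

Lemma cexpect_conj f : cintegrable mu f ->
  cexpect mu (fun w => conjc (f w)) = conjc (cexpect mu f).
Proof.
move=> [_ fi]; rewrite /cexpect /=; congr Complex.
  by apply: eq_Rintegral => w _; rewrite /rvRe; case: (f w).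
rewrite -mulN1r -RintegralZl //; apply: eq_Rintegral => w _.
by rewrite /rvIm mulN1r; case: (f w).
Qed.

(* From E|f^* - t g|^2 >= 0 for all real t. *)
Lemma sqr_Re_cexpect_le f g : L2 mu f -> L2 mu g ->
  complex.Re (cexpect mu (fun w => f w * g w)) ^+ 2 <=
  Rintegral mu setT (fun w => cmod (f w) ^+ 2) *
  Rintegral mu setT (fun w => cmod (g w) ^+ 2).
Proof.
move=> f2 g2; set s := complex.Re _; set a := Rintegral _ _ _; set b := Rintegral _ _ _.
have a0 : 0 <= a by apply: Rintegral_ge0 => w _; rewrite sqr_ge0.
have b0 : 0 <= b by apply: Rintegral_ge0 => w _; rewrite sqr_ge0.
have H (t : R) : 0 <= a - 2 * t * s + t ^+ 2 * b.
  have [fgr _] := L2_mul f2 g2.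
  have [_ [_ fi]] := f2; have [_ [_ gi]] := g2.
  have Zr (r : R) (u : T -> R) : mu.-integrable setT (EFin \o u) ->
      mu.-integrable setT (EFin \o (fun w => r * u w)).
    by move=> iu; apply: eq_integrable (integrableZl _ r iu).
  have -> : a - 2 * t * s + t ^+ 2 * b = Rintegral mu setT (fun w =>
      cmod (f w) ^+ 2 - 2 * t * rvRe (fun w => f w * g w) w + t ^+ 2 * cmod (g w) ^+ 2).
    rewrite RintegralD //; last by apply: Zr.
      by rewrite RintegralB ?RintegralZl //; apply: Zr.
    by apply: eq_integrable (integrableB _ fi (Zr (2 * t) _ fgr)).
  apply: Rintegral_ge0 => w _; rewrite /rvRe ReM !sqr_cmod.
  move: (complex.Re (f w)) (complex.Im (f w)) (complex.Re (g w)) (complex.Im (g w)).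
  move=> x y u v.
  have -> : x ^+ 2 + y ^+ 2 - 2 * t * (x * u - y * v) + t ^+ 2 * (u ^+ 2 + v ^+ 2) =
    (x - t * u) ^+ 2 + (y + t * v) ^+ 2 by ring.
  by rewrite addr_ge0 ?sqr_ge0.
move: b0; rewrite le0r => /orP[/eqP b_eq0|b_gt0].
  (* For b = 0, [H] is affine in t; if s were nonzero, t = (a + 1) / (2 s) would give the value
     -1. *)
  rewrite b_eq0 mulr0; have [->|s0] := eqVneq s 0; first by rewrite expr0n.
  have := H ((a + 1) / (2 * s)); rewrite b_eq0 mulr0 addr0.
  have -> : a - 2 * ((a + 1) / (2 * s)) * s = -1 by field.
  by rewrite oppr_ge0 ler10.
(* t = s / b minimises the quadratic in [H]. *)
have := H (s / b); have -> : a - 2 * (s / b) * s + (s / b) ^+ 2 * b = a - s ^+ 2 / b.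
  by field; rewrite gt_eqF.
by rewrite subr_ge0 ler_pdivrMr.
Qed.

End Expectation.

(** * Wick polynomials and cumulants *)

Section Wick.
Variables (d : measure_display) (T : measurableType d) (R : realType).
Variable (mu : probability T R).
Local Notation C := R[i].

Definition moment (n : nat) (Y : 'I_n -> crv T R) (A : {set 'I_n}) : C :=
  cexpect mu (rvprod Y A).

Lemma rvprod0 (n : nat) (Y : 'I_n -> crv T R) : rvprod Y finset.set0 = fun=> 1.
Proof. by apply/funext => w; rewrite /rvprod big_set0. Qed.

Lemma moment0 (n : nat) (Y : 'I_n -> crv T R) : moment Y finset.set0 = 1.
Proof. by rewrite /moment rvprod0 cexpect1. Qed.

Lemma cumulantE (n : nat) (Y : 'I_n -> crv T R) :
  cumulant mu Y = mobius (moment Y) finset.setT.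
Proof. by []. Qed.

Section OneFamily.
Variables (n : nat) (Y : 'I_n -> crv T R).
Hypothesis Y2 : forall A, L2 mu (rvprod Y A).
Implicit Types A E : {set 'I_n}.

(** Lets the single fuel [n] serve all subsets, so that the Wick recursion becomes a convolution
    identity. *)
Lemma wick_aux_fuel k k' A : (#|A| <= k)%N -> (#|A| <= k')%N ->
  wick_aux mu Y k A = wick_aux mu Y k' A.
Proof.
suff H m A' : (#|A'| <= m)%N -> wick_aux mu Y m.+1 A' = wick_aux mu Y m A'.
  have {}H m A' : (#|A'| <= m)%N -> wick_aux mu Y m A' = wick_aux mu Y #|A'| A'.
    elim: m => [|m IH]; first by rewrite leqn0 => /eqP ->.
    rewrite leq_eqVlt => /orP[/eqP -> //|]; rewrite ltnS => Am.
    by rewrite H // IH.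
  by move=> Ak Ak'; rewrite H // [RHS]H.
elim: m A' => [|m IH] A' Am; apply/funext => w.
  have /eqP -> : A' == finset.set0 by rewrite -cards_eq0 -leqn0.
  rewrite /= rvprod0 big1 ?subr0 // => E.
  by rewrite properE finset.sub0set andbF.
rewrite [LHS]/= [RHS]/=; congr (_ - _); apply: eq_bigr => E /proper_card EA.
by congr (_ * _); rewrite -IH //= -ltnS (leq_trans EA).
Qed.

Lemma wick_sum A w :
  \sum_(E : {set 'I_n} | E \subset A) moment Y (A :\: E) * wick_aux mu Y n E w =
  rvprod Y A w.
Proof.
have An : (#|A| <= n)%N by rewrite -[leqRHS]card_ord max_card.
(* The term E = A receives one more unit of fuel, so that unfolding it once leaves the proper
   subsets at fuel [n]. *)
rewrite (bigD1 A) //= finset.setDv moment0 mul1r (@wick_aux_fuel _ n.+1) //; last exact: ltnW.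
rewrite /= addrAC -addrA; apply/eqP; rewrite -subr_eq0 addrAC subrr add0r subr_eq0.
by apply/eqP; apply: eq_bigl => E; rewrite finset.properEneq andbC.
Qed.

Lemma L2_wick_aux k A : L2 mu (wick_aux mu Y k A).
Proof.
elim: k A => [|k IH] A /=; first exact: L2_cst.
have -> : (fun w : T => rvprod Y A w -
     \sum_(E : {set 'I_n} | E \proper A) cexpect mu (rvprod Y (A :\: E)) * wick_aux mu Y k E w) =
   (fun w => rvprod Y A w + (-1) *
     \sum_(E : {set 'I_n} | E \proper A) cexpect mu (rvprod Y (A :\: E)) * wick_aux mu Y k E w).
  by apply/funext => w; rewrite mulN1r.
apply: L2D => //; apply: L2Z; apply: L2_sum => E _.
exact: L2Z.
Qed.

(** [wick_sum] tested against X: X = 1 will give the centering of Wick polynomials, general X the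
    cumulant formula. *)
Lemma setconv_cexpect_wick (X : crv T R) A : L2 mu X ->
  setconv (fun E => cexpect mu (fun w => X w * wick_aux mu Y n E w)) (moment Y) A =
  cexpect mu (fun w => X w * rvprod Y A w).
Proof.
move=> X2; rewrite /setconv.
have XW E : cintegrable mu (fun w => X w * wick_aux mu Y n E w).
  by apply: L2_mul => //; exact: L2_wick_aux.
under eq_bigr do rewrite mulrC -cexpectZ //.
rewrite -cexpect_sum; last by move=> E _; exact: cintegrableZ.
congr cexpect; apply/funext => w; rewrite -wick_sum big_distrr /=.
by apply: eq_bigr => E _; rewrite mulrCA.
Qed.

(** Both E[:Y^E:] and the convolution unit [delta] give the moments when convolved with them, so
    they agree; [delta] vanishes at nonempty sets. *)
Lemma cexpect_wick : (0 < n)%N -> cexpect mu (wick mu Y) = 0.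
Proof.
move=> n0; pose delta E : C := (E == finset.set0)%:R.
have W1 : (fun E => cexpect mu (fun w => 1 * wick_aux mu Y n E w)) =
    fun E => cexpect mu (wick_aux mu Y n E).
  by apply/funext => E; congr cexpect; apply/funext => w; rewrite mul1r.
have := @setconv_eq0 _ _ (fun E => cexpect mu (wick_aux mu Y n E) - delta E) _ (moment0 Y).
have d0 : forall A, setconv (fun E => cexpect mu (wick_aux mu Y n E) - delta E) (moment Y) A = 0.
  move=> A; rewrite setconvBl -W1 setconv_cexpect_wick; last exact: L2_cst.
  rewrite setconv_first /delta eqxx mul1r big1 ?addr0 => [|E EA].
    apply/eqP; rewrite subr_eq0; apply/eqP; congr cexpect.
    by apply/funext => w; rewrite mul1r.
  rewrite finset.setD_eq0 [_ \subset _]negbTE ?mulr0 //.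
  by move: EA; rewrite properE => /andP[].
move=> /(_ d0 finset.setT) /eqP.
rewrite /delta [_ == finset.set0]negbTE ?subr0 => [/eqP //|].
by rewrite -card_gt0 cardsT card_ord.
Qed.

(** Convolved with the moments of Y, both sides, as functions of the set of positions, give
    E[X Y^A]: the cumulants by the moment-cumulant relation marked at X, the Wick pairings by
    [setconv_cexpect_wick]. *)
Lemma cumulant_rvcons (X : crv T R) : L2 mu X ->
  cumulant mu (rvcons X Y) = cexpect mu (fun w => X w * wick mu Y w).
Proof.
move=> X2; pose m' := moment (rvcons X Y).
have lI : injective (lift (@ord0 n)) by exact: lift_inj.
have l0 (A : {set 'I_n}) : ord0 \notin lift ord0 @: A.
  by apply/imsetP => -[i _] /eqP; rewrite (negPf (neq_lift _ _)).
have rvl A : rvprod (rvcons X Y) (lift ord0 @: A) = rvprod Y A.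
  apply/funext => w; rewrite /rvprod big_imset /=; last by move=> i j _ _; apply: lI.
  by apply: eq_bigr => i _; rewrite /rvcons liftK.
have mX A : m' (ord0 |: lift ord0 @: A) = cexpect mu (fun w => X w * rvprod Y A w).
  congr cexpect; apply/funext => w; rewrite -rvl /rvprod big_setU1 //=.
  by rewrite {1}/rvcons unlift_none.
pose kX A := mobius m' (ord0 |: lift ord0 @: A).
have kXE A : setconv kX (moment Y) A = cexpect mu (fun w => X w * rvprod Y A w).
  rewrite -mX /m' (setexp_U1 (mobius_setexp (moment0 _)) (l0 A)) big_subset_imset //.
  by apply: eq_bigr => E _; rewrite -imset_setD // [in RHS]/moment rvl.
have -> : cumulant mu (rvcons X Y) = kX finset.setT.
  rewrite cumulantE; congr mobius; apply/setP => i; rewrite !inE.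
  by case: (unliftP ord0 i) => [j ->|->]; rewrite ?eqxx // imset_f ?orbT.
apply/eqP; rewrite -subr_eq0; apply/eqP.
apply: (@setconv_eq0 _ _ (fun A => kX A - cexpect mu (fun w => X w * wick_aux mu Y n A w))
  _ (moment0 Y)) => A.
by rewrite setconvBl kXE setconv_cexpect_wick // subrr.
Qed.

(** Centering costs nothing because E[:Y:] = 0, and it turns E|X|^2 into the covariance in
    Cauchy-Schwarz. *)
Lemma cumulant_rvcons_centered (X : crv T R) : (0 < n)%N -> L2 mu X ->
  cumulant mu (rvcons X Y) =
  cexpect mu (fun w => (X w - cexpect mu X) * wick mu Y w).
Proof.
move=> n0 X2; rewrite cumulant_rvcons //.
have W2 : L2 mu (wick mu Y) by exact: L2_wick_aux.
have -> : (fun w => (X w - cexpect mu X) * wick mu Y w) =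
  fun w => X w * wick mu Y w + (- cexpect mu X) * wick mu Y w.
  by apply/funext => w; rewrite mulrDl.
rewrite cexpectD; last exact/cintegrableZ/L2_cintegrable.
  by rewrite cexpectZ ?cexpect_wick ?mulr0 ?addr0 //; exact: L2_cintegrable.
exact: L2_mul.
Qed.

Lemma conjc_wick w :
  conjc (wick mu Y w) = wick mu (fun i w' => conjc (Y i w')) w.
Proof.
have rc A w' : conjc (rvprod Y A w') = rvprod (fun i w' => conjc (Y i w')) A w'.
  exact: (rmorph_prod (@conjc R)).
suff H k A : conjc (wick_aux mu Y k A w) =
    wick_aux mu (fun i w' => conjc (Y i w')) k A w by exact: H.
elim: k A => [|k IH] A /=; first exact: conjc1.
rewrite rmorphB rmorph_sum /= rc; congr (_ - _); apply: eq_bigr => E _.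
rewrite conjcM IH -cexpect_conj; last exact: L2_cintegrable.
by congr (cexpect mu _ * _); apply/funext => w'; rewrite rc.
Qed.

End OneFamily.

(** * Pairing of two Wick polynomials *)

Section TwoFamilies.
Variables (n : nat) (Y1 Y2 : 'I_n -> crv T R).
Hypothesis Y1sq : forall A, L2 mu (rvprod Y1 A).
Hypothesis Y2sq : forall A, L2 mu (rvprod Y2 A).

Definition joint_moment (S : {set 'I_n + 'I_n}) : C :=
  cexpect mu (fun w => rvprod Y1 (lpart S) w * rvprod Y2 (rpart S) w).

Definition wick_pairing (S : {set 'I_n + 'I_n}) : C :=
  cexpect mu (fun w => wick_aux mu Y1 n (lpart S) w * wick_aux mu Y2 n (rpart S) w).

Lemma wick_pairing_setexp :
  is_setexp (crossing (mobius joint_moment)) wick_pairing.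
Proof.
have m0 : joint_moment finset.set0 = 1.
  rewrite /joint_moment.
  have -> : lpart (I := 'I_n) (J := 'I_n) finset.set0 = finset.set0.
    by apply/setP => i; rewrite !inE.
  have -> : rpart (I := 'I_n) (J := 'I_n) finset.set0 = finset.set0.
    by apply/setP => i; rewrite !inE.
  rewrite !rvprod0 -[RHS](cexpect1 mu); congr cexpect; apply/funext => w.
  by rewrite mulr1.
apply: setexp_crossing (mobius_setexp m0) _ => A B.
have ml U : joint_moment (bisjoin U finset.set0) = moment Y1 U.
  rewrite /joint_moment lpart_join rpart_join rvprod0; congr cexpect.
  by apply/funext => w; rewrite mulr1.
have mr U : joint_moment (bisjoin finset.set0 U) = moment Y2 U.
  rewrite /joint_moment lpart_join rpart_join rvprod0; congr cexpect.
  by apply/funext => w; rewrite mul1r.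
have WW E F : cintegrable mu (fun w => wick_aux mu Y1 n E w * wick_aux mu Y2 n F w).
  by apply: L2_mul; exact: L2_wick_aux.
(* [wick_sum] recombines the right half here and the left half at the end. *)
transitivity (\sum_(E : {set 'I_n} | E \subset A) cexpect mu (fun w =>
    moment Y1 (A :\: E) * wick_aux mu Y1 n E w * rvprod Y2 B w)).
  apply: eq_bigr => E _.
  have -> : (fun w => moment Y1 (A :\: E) * wick_aux mu Y1 n E w * rvprod Y2 B w) =
     (fun w => \sum_(F : {set 'I_n} | F \subset B)
        (moment Y1 (A :\: E) * moment Y2 (B :\: F)) *
        (wick_aux mu Y1 n E w * wick_aux mu Y2 n F w)).
    apply/funext => w; rewrite -wick_sum big_distrr /=; apply: eq_bigr => F _; ring.
  rewrite cexpect_sum => [|F _]; last exact: cintegrableZ.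
  apply: eq_bigr => F _; rewrite cexpectZ // ml mr /wick_pairing lpart_join rpart_join.
  by rewrite mulrC.
rewrite -cexpect_sum => [|E _]; last first.
  apply: L2_mul => //; apply: L2Z; exact: L2_wick_aux.
rewrite /joint_moment lpart_join rpart_join; congr cexpect; apply/funext => w.
by rewrite -[in RHS]wick_sum big_distrl.
Qed.

End TwoFamilies.
End Wick.

(** * Clustering norms *)

Section ExtendedSums.
Variable R : realType.

Lemma sum_le_esum (U : finType) (V : choiceType) (h : U -> V) (P : pred U) (F : V -> R) :
  {in P &, injective h} -> (forall v, 0 <= F v) ->
  ((\sum_(u | P u) F (h u))%:E <= \esum_(v in [set: V]) (F v)%:E)%E.
Proof.
move=> hI F0; pose D : set U := [set u | u \in P].
have Dinj : set_inj D h by move=> u v; rewrite !inE => Pu Pv; apply: hI.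
apply: esum_ge; exists (h @` D); first by split => //; exact/finite_image/finite_finset.
rewrite (fsbig_image _ _ _ Dinj) -sumEFin.
by rewrite (bigfs _ (index_enum_uniq U)) // => u _; rewrite mem_index_enum.
Qed.

(** A finite set of tuples lies in the box W^n, where W collects all their coordinates. *)
Lemma esum_box_le (Z : choiceType) (z0 : Z) n (F : ('I_n -> Z) -> R) (B : R) :
  (forall y, 0 <= F y) ->
  (forall (W : finType) (w0 : W) (zeta : W -> Z), injective zeta ->
     \sum_(x : {ffun 'I_n -> W}) F (fun i => zeta (x i)) <= B) ->
  (\esum_(y in [set: 'I_n -> Z]) (F y)%:E <= B%:E)%E.
Proof.
move=> F0 FB; apply: ge_ereal_sup => _ [A [finA _] <-].
rewrite fsbig_finite // sumEFin lee_fin.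
(* Including [z0] makes W nonempty even when there are no tuples or n = 0. *)
pose s := z0 :: flatten [seq [seq y i | i <- enum 'I_n] | y <- finmap.enum_fset (fset_set A)].
pose W : finType := seq_sub s.
pose w0 : W := SeqSub (mem_head z0 _).
pose c (y : 'I_n -> Z) : {ffun 'I_n -> W} := [ffun i => insubd w0 (y i)].
have cE y : y \in finmap.enum_fset (fset_set A) -> (fun i => val (c y i)) = y.
  move=> yA; apply/funext => i; rewrite ffunE insubdK // inE; apply/orP; right.
  by apply/flattenP; exists [seq y i | i <- enum 'I_n]; [exact: map_f | exact/map_f/mem_enum].
apply: le_trans (FB W w0 val val_inj).
rewrite (eq_big_seq (fun y => F (fun i => val (c y i)))); last by move=> y /cE ->.
rewrite -(big_map c xpredT (fun x => F (fun i => val (x i)))) big_uniq; last first.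
  rewrite map_inj_in_uniq ?finmap.fset_uniq // => y y' yA y'A cc.
  by rewrite -(cE _ yA) -(cE _ y'A) cc.
by rewrite big_mkcond; apply: ler_sum => x _; case: ifP.
Qed.

End ExtendedSums.

(** The prescribed first element will be the fixed site, which the clustering norm takes as first
    argument of the cumulant. *)
Lemma enum_from (X : finType) (S : {set X}) (a : X) : a \in S ->
  exists m (f : 'I_m.+1 -> X),
    [/\ injective f, f @: finset.setT = S, f ord0 = a & #|S| = m.+1].
Proof.
move=> aS; pose s := enum (S :\ a).
have us : uniq (a :: s) by rewrite /= mem_enum setD11 enum_uniq.
exists (size s), (fun i => nth a (a :: s) i); split=> //.
- by move=> i j /eqP; rewrite nth_uniq ?ltn_ord // => /eqP /val_inj.
- apply/setP => b; apply/imsetP/idP => [[i _ ->]|bS].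
    have := mem_nth a (ltn_ord i : (i < size (a :: s))%N).
    by rewrite inE mem_enum => /orP[/eqP ->//|]; rewrite inE => /andP[].
  have bs : b \in a :: s by rewrite inE mem_enum !inE bS andbT orbN.
  have ib : (index b (a :: s) < (size s).+1)%N by rewrite -index_mem in bs.
  by exists (Ordinal ib) => //; rewrite nth_index.
- by rewrite /s -cardE (cardsD1 a) aS.
Qed.

(** * Moments, cumulants and clustering norms of the field *)

Section Field.
Variables (d : measure_display) (T : measurableType d) (R : realType).
Variable (mu : probability T R).
Variables (Z : countType) (phi : Z -> crv T R) (N : nat).
Hypothesis phi_mom : moments_upto mu phi (2 * N).
Variable star : Z -> Z.
Hypothesis starP : forall z w, conjc (phi z w) = phi (star z) w.

Lemma cintegrable_seq_prod (s : seq Z) : (size s <= 2 * N)%N ->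
  cintegrable mu (fun w => \prod_(z <- s) phi z w).
Proof.
move=> sN; have := phi_mom (fun i : 'I_(size s) => tnth (in_tuple s) i) sN.
congr cintegrable; apply/funext => w; rewrite /rvprod (big_tnth _ _ s).
by apply: eq_bigl => i; rewrite inE.
Qed.

(** Closure under conjugation writes the squared modulus as a product of twice as many field values;
    hence moments up to 2N. *)
Lemma L2_seq_prod (s : seq Z) : (size s <= N)%N ->
  L2 mu (fun w => \prod_(z <- s) phi z w).
Proof.
move=> sN; have [ir ii] := cintegrable_seq_prod (leq_trans sN (@leq_pmull N 2 isT)).
split; first exact/measurable_EFinP/measurable_int/ir.
split; first exact/measurable_EFinP/measurable_int/ii.
have [|jr _] := cintegrable_seq_prod (s := [seq star z | z <- s] ++ s).
  by rewrite size_cat size_map addnn -mul2n leq_mul2l sN orbT.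
apply: eq_integrable jr => // w _ /=; congr (_%:E).
rewrite /rvRe big_cat big_map /=.
under eq_bigr do rewrite -starP.
by rewrite -(rmorph_prod (@conjc R)) conjc_mulC.
Qed.

Lemma L2_field n (x : 'I_n -> Z) (A : {set 'I_n}) : (n <= N)%N ->
  L2 mu (rvprod (fun i => phi (x i)) A).
Proof.
move=> nN; have -> : rvprod (fun i => phi (x i)) A =
    fun w => \prod_(z <- [seq x i | i <- enum A]) phi z w.
  by apply/funext => w; rewrite big_map big_enum.
apply: L2_seq_prod; rewrite size_map -cardE.
by rewrite (leq_trans _ nN) // -[leqRHS]card_ord max_card.
Qed.

Section Blocks.
Variables (n : nat) (x1 x2 : 'I_n -> Z).

Definition site (s : 'I_n + 'I_n) : Z := match s with inl i => x1 i | inr j => x2 j end.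

Notation jm := (joint_moment mu (fun i => phi (x1 i)) (fun i => phi (x2 i))).

Lemma joint_momentE (S : {set 'I_n + 'I_n}) :
  jm S = cexpect mu (fun w => \prod_(s in S) phi (site s) w).
Proof.
congr cexpect; apply/funext => w; rewrite big_sumType /=.
by congr (_ * _); apply: eq_bigl => i; rewrite inE.
Qed.

Lemma mobius_joint_moment m (f : 'I_m.+1 -> 'I_n + 'I_n) : injective f ->
  mobius jm (f @: finset.setT) =
  cumulant mu (rvcons (phi (site (f ord0))) (fun i => phi (site (f (lift ord0 i))))).
Proof.
move=> fI; rewrite -mobius_imset //; last first.
- by apply/set0Pn; exists ord0; rewrite inE.
- by rewrite joint_momentE -[RHS](cexpect1 mu); congr cexpect; apply/funext => w; rewrite big_set0.
rewrite cumulantE; congr mobius; apply/funext => A; rewrite joint_momentE.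
congr cexpect; apply/funext => w; rewrite /rvprod big_imset /=; last by move=> i j _ _; apply: fI.
by apply: eq_bigr => i _; rewrite /rvcons; case: unliftP => [j ->|->].
Qed.

End Blocks.

Lemma clust_norm_ge0 p m (z : Z) : (0 <= clust_norm mu phi p m.+2)%E.
Proof.
have : (poweR (\esum_(y in [set: 'I_m.+1 -> Z])
    (cmod (cumulant mu (rvcons (phi z) (fun i => phi (y i)))) `^ p)%:E) p^-1
    <= clust_norm mu phi p m.+2)%E by apply: ereal_sup_ubound; exists z.
by apply: le_trans; exact: poweR_ge0.
Qed.

(** Distinct tuples select distinct terms of the sum in the norm. The order is at least 2, where the
    norm is a sum; a block meeting both halves always has such an order. *)
Lemma clust_norm_fin_bound q m (U : finType) (P : pred U) (z : Z) (h : U -> 'I_m.+1 -> Z) :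
  (0 < q)%N -> (clust_norm mu phi q%:R m.+2 < +oo)%E -> {in P &, injective h} ->
  \sum_(u | P u) cmod (cumulant mu (rvcons (phi z) (fun i => phi (h u i)))) ^+ q <=
  fine (clust_norm mu phi q%:R m.+2) ^+ q.
Proof.
move=> q0 fin hI.
set c := clust_norm mu phi _ _.
pose F (y : 'I_m.+1 -> Z) := cmod (cumulant mu (rvcons (phi z) (fun i => phi (y i)))) `^ q%:R.
have F0 y : 0 <= F y by exact: powR_ge0.
have Sc : (poweR (\esum_(y in [set: 'I_m.+1 -> Z]) (F y)%:E) (q%:R)^-1 <= c)%E.
  by apply: ereal_sup_ubound; exists z.
have c0 : (0 <= c)%E by exact: clust_norm_ge0 z.
have cfin : c \is a fin_num by rewrite ge0_fin_numE.
have qn0 : q%:R != 0 :> R by rewrite pnatr_eq0 -lt0n.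
have S0 : (0 <= \esum_(y in [set: 'I_m.+1 -> Z]) (F y)%:E)%E.
  by apply: esum_ge0 => y _; rewrite lee_fin.
have Sq : (\esum_(y in [set: 'I_m.+1 -> Z]) (F y)%:E <= (fine c ^+ q)%:E)%E.
  rewrite -(poweRe1 S0) -(mulVf qn0) poweRrM.
  rewrite -powR_mulrn ?fine_ge0 // -poweR_EFin fineK //.
  apply: gt0_ler_poweR => //.
  - by rewrite in_itv /= poweR_ge0 leey.
  - by rewrite in_itv /= c0 leey.
rewrite -lee_fin; apply: le_trans Sq.
have := sum_le_esum hI F0; congr (_%:E <= _)%E; apply: eq_bigr => u _.
by rewrite /F powR_mulrn // cmod_ge0.
Qed.

Lemma Mconst_ge0 p K : 0 <= Mconst mu phi p K.
Proof. by rewrite /Mconst; apply: bigmax_ge_id. Qed.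

Lemma clust_norm_le_Mconst p K e : (0 < e <= K)%N -> (0 <= clust_norm mu phi p e)%E ->
  fine (clust_norm mu phi p e) <= e`!%:R * Mconst mu phi p K ^+ e.
Proof.
move=> /andP[e0 eK] c0; set c := fine _.
have c0' : 0 <= c / e`!%:R by rewrite divr_ge0 ?ler0n // fine_ge0.
have cM : (c / e`!%:R) `^ (e%:R^-1) <= Mconst mu phi p K.
  apply: (@le_bigmax_seq _ _ _ _ _ e) => //.
  by rewrite mem_index_iota e0 ltnS.
rewrite -ler_pdivrMl ?ltr0n ?fact_gt0 // mulrC.
move: (c / _) c0' cM => b b0 bM.
rewrite -(powRr1 b0) -(mulVf (_ : e%:R != 0 :> R)) ?pnatr_eq0 -?lt0n // powRrM.
rewrite powR_mulrn ?powR_ge0 //.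
by apply: lerXn2r; rewrite ?nnegrE ?powR_ge0 ?Mconst_ge0.
Qed.

End Field.

Lemma eq_mobius (K : comNzRingType) (I : finType) (m m' : {set I} -> K) (E : {set I}) :
  (forall B : {set I}, B \subset E -> m B = m' B) -> mobius m E = mobius m' E.
Proof.
move=> mm'; apply: eq_bigr => P hP; congr (_ * _); apply: eq_bigr => B BP.
by apply: mm'; exact: partitionS hP BP.
Qed.

(** * Testing a random variable against finite combinations *)

Section QuadraticForm.
Variables (d : measure_display) (T : measurableType d) (R : realType).
Variable (mu : probability T R).

Lemma Rintegral_sqr_cmod (Y : crv T R) : L2 mu Y ->
  Rintegral mu setT (fun w => cmod (Y w) ^+ 2) =
  complex.Re (cexpect mu (fun w => conjc (Y w) * Y w)).
Proof. by move=> Y2; apply: eq_Rintegral => w _; rewrite /rvRe conjc_mulC. Qed.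

(** The phase of [f u] makes every term of E[X Y] nonnegative. In E|Y|^2 all phases are dropped by
    the triangle inequality, so only moduli of the Gram matrix enter. *)
Lemma weighted_sum_le (U : finType) (w_ : U -> crv T R) (X : crv T R)
    (g k : U -> R) (Phi : U -> U -> R) :
  (forall u, L2 mu (w_ u)) -> L2 mu X -> (forall u, 0 <= g u) ->
  (forall u, k u = cmod (cexpect mu (fun w => X w * w_ u w))) ->
  (forall u v, Phi u v = cmod (cexpect mu (fun w => conjc (w_ u w) * w_ v w))) ->
  (\sum_u g u * k u ^+ 2) ^+ 2 <=
  Rintegral mu setT (fun w => cmod (X w) ^+ 2) *
  \sum_u \sum_v (g u * k u) * (g v * k v) * Phi u v.
Proof.
move=> w2 X2 g0 kE PhiE.
pose kc u := cexpect mu (fun w => X w * w_ u w).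
pose f u : R[i] := ((g u)%:C)%C * conjc (kc u).
pose Y : crv T R := fun w => \sum_u f u * w_ u w.
have Y2 : L2 mu Y by apply: L2_sum => u _; exact: L2Z.
have fE u : cmod (f u) = g u * k u by rewrite /f cmodM cmod_conjc cmod_real // kE.
have XY : cexpect mu (fun w => X w * Y w) = ((\sum_u g u * k u ^+ 2)%:C)%C.
  have -> : (fun w => X w * Y w) = fun w => \sum_u f u * (X w * w_ u w).
    by apply/funext => w; rewrite /Y big_distrr; apply: eq_bigr => u _; rewrite /= mulrCA.
  rewrite cexpect_sum => [|u _]; last exact/cintegrableZ/L2_mul.
  rewrite real_complex_sum; apply: eq_bigr => u _.
  rewrite cexpectZ; last exact: L2_mul.
  by rewrite /f -mulrA conjc_mulC kE -rmorphM.
have ww u v : cintegrable mu (fun w => conjc (w_ u w) * w_ v w).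
  by apply: L2_mul => //; exact: L2_conj.
have YY : cexpect mu (fun w => conjc (Y w) * Y w) =
  \sum_u \sum_v conjc (f u) * f v * cexpect mu (fun w => conjc (w_ u w) * w_ v w).
  have -> : (fun w => conjc (Y w) * Y w) = fun w => \sum_u \sum_v
      (conjc (f u) * f v) * (conjc (w_ u w) * w_ v w).
    apply/funext => w; rewrite /Y conjc_sum big_distrlr.
    apply: eq_bigr => u _; apply: eq_bigr => v _.
    by rewrite [X in X * _ = _]conjcM mulrACA.
  rewrite cexpect_sum => [|u _]; last by apply: cintegrable_sum => v _; exact: cintegrableZ.
  apply: eq_bigr => u _; rewrite cexpect_sum => [|v _]; last exact: cintegrableZ.
  by apply: eq_bigr => v _; rewrite cexpectZ.
have := sqr_Re_cexpect_le X2 Y2; rewrite XY /= => Q.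
apply: le_trans Q _; apply: ler_wpM2l; first by apply: Rintegral_ge0 => w _; rewrite sqr_ge0.
rewrite Rintegral_sqr_cmod // YY.
apply: le_trans (le_trans (ler_norm _) (normr_Re_le _)) _.
apply: le_trans (cmod_sum _ _ _) _; apply: ler_sum => u _.
apply: le_trans (cmod_sum _ _ _) _; apply: ler_sum => v _.
by rewrite cmodM [cmod (_ * f v)]cmodM cmod_conjc !fE PhiE.
Qed.

Lemma Rintegral_centered (X : crv T R) : L2 mu X ->
  Rintegral mu setT (fun w => cmod (X w - cexpect mu X) ^+ 2) = covXX mu X.
Proof.
move=> X2; have [Xr Xi] := L2_cintegrable X2; have [_ [_ X2i]] := X2.
have Zr (r : R) (u : T -> R) : mu.-integrable setT (EFin \o u) ->
    mu.-integrable setT (EFin \o (fun w => r * u w)).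
  by move=> iu; apply: eq_integrable (integrableZl _ r iu).
have Dr (u v : T -> R) : mu.-integrable setT (EFin \o u) ->
    mu.-integrable setT (EFin \o v) ->
    mu.-integrable setT (EFin \o (fun w => u w + v w)).
  by move=> iu iv; apply: eq_integrable (integrableD _ iu iv).
set m := cexpect mu X; pose a := complex.Re m; pose b := complex.Im m.
have aE : Rintegral mu setT (rvRe X) = a by [].
have bE : Rintegral mu setT (rvIm X) = b by [].
have ic : mu.-integrable setT (EFin \o (fun=> a ^+ 2 + b ^+ 2)).
  exact: (@finite_measure_integrable_cst _ _ _ mu setT).
rewrite /covXX -/m.
transitivity (Rintegral mu setT (fun w => cmod (X w) ^+ 2 +
   ((-2 * a) * rvRe X w + ((-2 * b) * rvIm X w + (a ^+ 2 + b ^+ 2))))).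
  apply: eq_Rintegral => w _; rewrite !sqr_cmod /rvRe /rvIm ReD ImD.
  have -> : complex.Re (- m) = - a by rewrite /a; case: (m).
  have -> : complex.Im (- m) = - b by rewrite /b; case: (m).
  ring.
rewrite RintegralD //; last by apply: (Dr) => //; [exact: Zr|apply: (Dr) => //; exact: Zr].
rewrite RintegralD //; [|exact: Zr|apply: (Dr) => //; exact: Zr].
rewrite RintegralD //; last exact: Zr.
rewrite !RintegralZl // Rintegral_cst // aE bE.
have -> : fine (mu setT) = 1 by rewrite probability_setT.
rewrite sqr_cmod -/a -/b; ring.
Qed.

End QuadraticForm.

(** * Row sums of Phi_n *)

Section RowBound.
Variables (d : measure_display) (T : measurableType d) (R : realType).
Variable (mu : probability T R).
Variables (Z : countType) (phi : Z -> crv T R) (N : nat).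
Hypothesis phi_mom : moments_upto mu phi (2 * N).
Variable star : Z -> Z.
Hypothesis starP : forall z w, conjc (phi z w) = phi (star z) w.
Variable n : nat.
Hypothesis nN : (n <= N)%N.

Notation field x := (fun i : 'I_n => phi (x i)).

Lemma L2_wick (x : 'I_n -> Z) : L2 mu (wick mu (field x)).
Proof.
apply: L2_wick_aux => A.
exact: (L2_field phi_mom starP).
Qed.

Lemma PhiW_conj (x y : 'I_n -> Z) :
  PhiW mu phi x y = cexpect mu (fun w => conjc (wick mu (field x) w) * wick mu (field y) w).
Proof.
congr cexpect; apply/funext => w; rewrite conjc_wick // => A.
exact: (L2_field phi_mom starP).
Qed.

(** Phi_n is a Gram matrix, hence Hermitian. *)
Lemma cmod_PhiWC (x y : 'I_n -> Z) : cmod (PhiW mu phi x y) = cmod (PhiW mu phi y x).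
Proof.
rewrite !PhiW_conj -cmod_conjc -cexpect_conj; last first.
  apply: L2_mul; last exact: L2_wick.
  exact/L2_conj/L2_wick.
by congr (cmod (cexpect mu _)); apply/funext => w; rewrite conjcM conjcK mulrC.
Qed.

Variables (q : nat).
Hypothesis q12 : (q = 1 \/ q = 2)%N.
Hypothesis clust : forall e, (1 <= e <= 2 * N)%N -> (clust_norm mu phi q%:R e < +oo)%E.
Variables (W : finType) (w0 : W) (zeta : W -> Z).
Hypothesis zetaI : injective zeta.

Local Notation M := (Mconst mu phi q%:R (2 * n)).

Lemma sum_PhiW_le (x : 'I_n -> Z) :
  \sum_(y : {ffun 'I_n -> W}) cmod (PhiW mu phi x (fun i => zeta (y i))) ^+ q <=
  ((2 * n)`!%:R * 2 ^+ (2 * n) * M ^+ (2 * n)) ^+ q.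
Proof.
(* With conjugates rewritten through [star], the left half holds field values at fixed sites. *)
pose sx i := star (x i).
pose jm (y : {ffun 'I_n -> W}) := joint_moment mu (field sx) (field (fun i => zeta (y i))).
pose G (y : {ffun 'I_n -> W}) := wick_pairing mu (field sx) (field (fun i => zeta (y i))).
have Fsq (y : 'I_n -> Z) A : L2 mu (rvprod (field y) A).
  exact: (L2_field phi_mom starP).
have Gexp y : is_setexp (crossing (mobius (jm y))) (G y).
  by apply: wick_pairing_setexp => A; exact: Fsq.
have M0 : 0 <= ((M%:C)%C : R[i]) by rewrite ler0c Mconst_ge0.
have k_local (E : {set 'I_n + 'I_n}) (y y' : {ffun 'I_n -> W}) :
    (forall j, j \in rpart E -> y j = y' j) -> mobius (jm y) E = mobius (jm y') E.
  move=> yy'; apply: eq_mobius => B; rewrite subset_parts => /andP[_ /fintype.subsetP BE].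
  congr cexpect; apply/funext => w; congr (_ * _); apply: eq_bigr => j jB.
  by rewrite yy' // BE.
have cardle (E : {set 'I_n + 'I_n}) : (#|E| <= 2 * n)%N.
  by apply: leq_trans (max_card _) _; rewrite card_sum !card_ord addnn mul2n.
(* [G_bound] is used over [R[i]], where the modulus is complex-valued; this translates to real
   sums. *)
have toC (U : finType) (P : pred U) (F : U -> R[i]) (b : R) :
    \sum_(u | P u) cmod (F u) ^+ q <= b ^+ q <->
    lq_le q P (fun u => `|F u|) ((b%:C)%C).
  rewrite /lq_le -real_complexX -lecR real_complex_sum.
  rewrite [X in _ <-> X <= _](eq_bigr (fun u => ((cmod (F u) ^+ q)%:C)%C)) // => u _.
  by rewrite real_complexX -normc_cmod.
have k_bound (E : {set 'I_n + 'I_n}) :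
    lpart E != finset.set0 -> rpart E != finset.set0 ->
    lq_le q (supp_in w0 (rpart E)) (fun y => `|mobius (jm y) E|)
      ((#|E|)`!%:R * ((M%:C)%C) ^+ #|E|).
  move=> /set0Pn[i iE] /set0Pn[j jE].
  (* Listing E from a left position puts a fixed site at the head of the cumulant. *)
  have [m [f [fI fE f0 Em]]] : exists m (f : 'I_m.+1 -> 'I_n + 'I_n),
      [/\ injective f, f @: finset.setT = E, f ord0 = inl i & #|E| = m.+1].
    by apply: enum_from; rewrite inE in iE.
  (* A one-element block cannot meet both halves. *)
  case: m f fI fE f0 Em => [|m] f fI fE f0 Em.
    rewrite inE in jE; have := jE; rewrite -fE => /imsetP[u _].
    by rewrite (ord1 u) f0.
  have -> : (#|E|)`!%:R * ((M%:C)%C) ^+ #|E| = (((#|E|)`!%:R * M ^+ #|E|)%:C)%C :> R[i].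
    by rewrite rmorphM rmorphXn rmorph_nat.
  apply/toC.
  have clE : (clust_norm mu phi q%:R m.+2 < +oo)%E.
    by apply: clust; rewrite /= -Em (leq_trans (cardle E)) // leq_mul2l nN orbT.
  pose h (y : {ffun 'I_n -> W}) (k : 'I_m.+1) :=
     site sx (fun i => zeta (y i)) (f (lift ord0 k)).
  (* Outside [rpart E] the configuration is frozen; inside, each coordinate appears among the listed
     sites, the omitted head being a left position. *)
  have hI : {in supp_in w0 (rpart E) &, injective h}.
    move=> y y' yE y'E hh; apply/ffunP => k.
    case: (boolP (k \in rpart E)) => kE; last first.
      by have := forallP yE k; have := forallP y'E k; rewrite kE => /eqP -> /eqP ->.
    have := kE; rewrite inE -fE => /imsetP[u _].
    case: (unliftP ord0 u) => [v ->|->] fu; last by rewrite f0 in fu.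
    by apply: zetaI; have := congr1 (@^~ v) hh; rewrite /h -fu.
  have q0 : (0 < q)%N by case: q12 => ->.
  have := clust_norm_fin_bound (star (x i)) q0 clE hI.
  have -> : \sum_(u | supp_in w0 (rpart E) u)
      cmod (cumulant mu (rvcons (phi (star (x i))) (fun k => phi (h u k)))) ^+ q =
     \sum_(u | supp_in w0 (rpart E) u) cmod (mobius (jm u) E) ^+ q.
    by apply: eq_bigr => y _; rewrite -[in RHS]fE mobius_joint_moment // f0.
  move=> /le_trans; apply.
  have cl0 : (0 <= clust_norm mu phi q%:R m.+2)%E.
    exact: clust_norm_ge0 (x i).
  apply: lerXn2r.
  - by rewrite nnegrE fine_ge0.
  - by rewrite nnegrE mulr_ge0 ?ler0n // exprn_ge0 // Mconst_ge0.
  by rewrite Em; apply: clust_norm_le_Mconst => //; rewrite /= -Em.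
have := G_bound q12 M0 Gexp k_local k_bound finset.setT.
have -> : rpart (finset.setT : {set 'I_n + 'I_n}) = finset.setT.
  by apply/setP => j; rewrite !inE.
have -> : #|(finset.setT : {set 'I_n + 'I_n})| = (2 * n)%N.
  by rewrite cardsT card_sum !card_ord addnn mul2n.
have -> : Gbound ((M%:C)%C) (2 * n) =
    (((2 * n)`!%:R * 2 ^+ (2 * n) * M ^+ (2 * n))%:C)%C.
  by rewrite /Gbound !rmorphM /= !rmorphXn /= !rmorph_nat.
move/toC; congr (_ <= _); apply: eq_big => y; last first.
  move=> _; congr (cmod _ ^+ q); rewrite /G /wick_pairing /PhiW.
  have -> : lpart (finset.setT : {set 'I_n + 'I_n}) = finset.setT.
    by apply/setP => j; rewrite !inE.
  have -> : rpart (finset.setT : {set 'I_n + 'I_n}) = finset.setT.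
    by apply/setP => j; rewrite !inE.
  congr cexpect; apply/funext => w; congr (_ * _); rewrite /wick.
  by congr (wick_aux mu _ _ _ w); apply/funext => k; apply/funext => w'; rewrite starP.
by apply/forallP => j; rewrite inE.
Qed.

End RowBound.

(** * Duality *)

Section RealKernels.
Variables (R : realType) (U : finType) (Phi : U -> U -> R) (B : R).
Hypotheses (Phi0 : forall u v, 0 <= Phi u v) (PhiC : forall u v, Phi u v = Phi v u).
Hypothesis B0 : 0 <= B.

(** 2 k_u k_v <= k_u^2 + k_v^2, and by symmetry both halves are controlled by the row sums. *)
Lemma schur_test (k : U -> R) : (forall u, \sum_v Phi u v <= B) ->
  \sum_u \sum_v k u * k v * Phi u v <= (\sum_u k u ^+ 2) * B.
Proof.
move=> rowB.
have half : \sum_u \sum_v k u ^+ 2 * Phi u v <= (\sum_u k u ^+ 2) * B.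
  rewrite big_distrl /=; apply: ler_sum => u _; rewrite -big_distrr /=.
  by rewrite ler_wpM2l ?sqr_ge0.
apply: (@le_trans _ _ (2^-1 * (\sum_u \sum_v k u ^+ 2 * Phi u v +
                               \sum_u \sum_v k v ^+ 2 * Phi u v))).
  rewrite -big_split big_distrr /=; apply: ler_sum => u _.
  rewrite -big_split big_distrr /=; apply: ler_sum => v _.
  have := Phi0 u v; have := sqr_ge0 (k u - k v).
  move: (k u) (k v) (Phi u v) => a b c; nra.
have -> : \sum_u \sum_v k v ^+ 2 * Phi u v = \sum_u \sum_v k u ^+ 2 * Phi u v.
  by rewrite exchange_big; apply: eq_bigr => u _; apply: eq_bigr => v _; rewrite PhiC.
lra.
Qed.

(** Cauchy-Schwarz over pairs, with g_u g_v shared as two square roots. The factor with k has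
    squared norm exactly (sum of g k^2)^2; the factor with Phi has squared norm at most B^4, by g_u
    g_v <= (g_u^2 + g_v^2) / 2, symmetry and both l^2 bounds. *)
Lemma hilbert_schmidt_test (g k : U -> R) : (forall u, 0 <= g u) -> (forall u, 0 <= k u) ->
  (forall u, \sum_v Phi u v ^+ 2 <= B ^+ 2) -> \sum_u g u ^+ 2 <= B ^+ 2 ->
  \sum_u \sum_v (g u * k u) * (g v * k v) * Phi u v <= (\sum_u g u * k u ^+ 2) * B ^+ 2.
Proof.
move=> g0 k0 rowB gB.
pose F p := Num.sqrt (g p.1 * g p.2) * (k p.1 * k p.2).
pose H p := Num.sqrt (g p.1 * g p.2) * Phi p.1 p.2.
have S0 : 0 <= \sum_u g u * k u ^+ 2 by apply: sumr_ge0 => u _; rewrite mulr_ge0 ?sqr_ge0.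
have gg (p : U * U) : Num.sqrt (g p.1 * g p.2) ^+ 2 = g p.1 * g p.2.
  by rewrite sqr_sqrtr // mulr_ge0.
rewrite pair_big /= (eq_bigr (fun p => F p * H p)); last first.
  move=> p _; rewrite /F /H.
  transitivity (Num.sqrt (g p.1 * g p.2) ^+ 2 * (k p.1 * k p.2) * Phi p.1 p.2); last by ring.
  by rewrite gg; ring.
apply: sum_mul_le => // [p|p|||]; rewrite ?mulr_ge0 ?sqrtr_ge0 ?sqr_ge0 //.
  rewrite expr2 big_distrlr pair_big /= le_eqVlt; apply/orP; left; apply/eqP.
  apply: eq_bigr => p _; rewrite /F exprMn gg; ring.
have half : \sum_u \sum_v g u ^+ 2 * Phi u v ^+ 2 <= (B ^+ 2) ^+ 2.
  apply: (@le_trans _ _ ((\sum_u g u ^+ 2) * B ^+ 2)).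
    rewrite big_distrl /=; apply: ler_sum => u _; rewrite -big_distrr /=.
    by rewrite ler_wpM2l ?sqr_ge0.
  by rewrite [leRHS]expr2 ler_wpM2r ?sqr_ge0.
apply: (@le_trans _ _ (2^-1 * (\sum_u \sum_v g u ^+ 2 * Phi u v ^+ 2 +
                               \sum_u \sum_v g v ^+ 2 * Phi u v ^+ 2))).
  rewrite !pair_big -big_split big_distrr /=; apply: ler_sum => p _.
  rewrite /H exprMn gg.
  have := sqr_ge0 (Phi p.1 p.2); have := sqr_ge0 (g p.1 - g p.2).
  move: (g p.1) (g p.2) (Phi p.1 p.2 ^+ 2) => a b c; nra.
have -> : \sum_u \sum_v g v ^+ 2 * Phi u v ^+ 2 = \sum_u \sum_v g u ^+ 2 * Phi u v ^+ 2.
  by rewrite exchange_big; apply: eq_bigr => u _; apply: eq_bigr => v _; rewrite PhiC.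
lra.
Qed.

End RealKernels.

(** Absorbs one factor of the sum being estimated, which is a real number because it is taken over a
    finite box. *)
Lemma le_of_sqr_le (R : realType) (s V c : R) : 0 <= s -> 0 <= V -> 0 <= c ->
  s ^+ 2 <= V * (s * c) -> s <= V * c.
Proof.
rewrite le0r => /orP[/eqP ->|s0] V0 c0; first by rewrite mulr_ge0.
by rewrite mulrCA expr2 ler_pM2l.
Qed.

(** * Bounds on finite boxes and passage to the full sums *)

Section Main.
Variables (d : measure_display) (T : measurableType d) (R : realType).
Variable (mu : probability T R).
Variables (Z : countType) (phi : Z -> crv T R) (N n : nat).
Hypothesis phi_mom : moments_upto mu phi (2 * N).
Hypothesis phi_conj : closed_under_conj phi.
Hypotheses (n0 : (0 < n)%N) (nN : (n <= N)%N).
Variable (X : crv T R).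
Hypothesis X2 : L2 mu X.

Let bound q : R := (2 * n)`!%:R * 2 ^+ (2 * n) * Mconst mu phi q%:R (2 * n) ^+ (2 * n).

Notation kap x := (cmod (cumulant mu (rvcons X (fun i : 'I_n => phi (x i))))).

Lemma covXX_ge0 : 0 <= covXX mu X.
Proof. by rewrite -Rintegral_centered //; apply: Rintegral_ge0 => w _; rewrite sqr_ge0. Qed.

Lemma bound_ge0 q : 0 <= bound q.
Proof. by rewrite /bound !mulr_ge0 ?exprn_ge0 ?ler0n ?Mconst_ge0. Qed.

Lemma star_exists : exists star : Z -> Z, forall z w, conjc (phi z w) = phi (star z) w.
Proof. by have [f fP] := choice phi_conj; exists f. Qed.

Section Box.
Variables (W : finType) (w0 : W) (zeta : W -> Z).
Hypothesis zetaI : injective zeta.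
Notation tup y := (fun i : 'I_n => zeta (y i)).

Lemma weighted_cumulants_le (g : {ffun 'I_n -> W} -> R) : (forall y, 0 <= g y) ->
  (\sum_y g y * kap (tup y) ^+ 2) ^+ 2 <= covXX mu X *
    \sum_u \sum_v (g u * kap (tup u)) * (g v * kap (tup v)) *
       cmod (PhiW mu phi (tup u) (tup v)).
Proof.
move=> g0; have [star starP] := star_exists.
rewrite -Rintegral_centered //.
have X2c : L2 mu (fun w => X w - cexpect mu X).
  exact: L2D X2 (L2_cst _ _).
apply: (@weighted_sum_le _ _ _ mu {ffun 'I_n -> W}
  (fun y : {ffun 'I_n -> W} => wick mu (fun i => phi (zeta (y i)))) _ g) => //.
- by move=> y; exact: (L2_wick phi_mom starP nN).
- move=> y; rewrite cumulant_rvcons_centered // => A.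
  exact: (L2_field phi_mom starP).
- by move=> u v; rewrite (PhiW_conj phi_mom starP nN).
Qed.

Lemma sum_sqr_cumulant_le :
  (forall e, (1 <= e <= 2 * N)%N -> (clust_norm mu phi 1 e < +oo)%E) ->
  \sum_(y : {ffun 'I_n -> W}) kap (tup y) ^+ 2 <= covXX mu X * bound 1.
Proof.
move=> fin; have [star starP] := star_exists.
apply: le_of_sqr_le; rewrite ?covXX_ge0 ?bound_ge0 //.
  by apply: sumr_ge0 => y _; rewrite sqr_ge0.
have := @weighted_cumulants_le (fun=> 1) (fun=> ler01).
under eq_bigr do rewrite mul1r.
move=> /le_trans; apply; apply: ler_wpM2l; first exact: covXX_ge0.
under eq_bigr do under eq_bigr do rewrite !mul1r.
apply: schur_test => [u v|u v|u]; first exact: cmod_ge0.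
  exact: (cmod_PhiWC phi_mom starP nN).
have q12 : (1 = 1 \/ 1 = 2)%N by left.
exact: (sum_PhiW_le phi_mom starP nN q12 fin w0 zetaI).
Qed.

Lemma sum_weighted_sqr_cumulant_le (x : 'I_n -> Z) :
  (forall e, (1 <= e <= 2 * N)%N -> (clust_norm mu phi 2 e < +oo)%E) ->
  \sum_(y : {ffun 'I_n -> W}) cmod (PhiW mu phi x (tup y)) * kap (tup y) ^+ 2
    <= covXX mu X * bound 2 ^+ 2.
Proof.
move=> fin; have [star starP] := star_exists.
apply: le_of_sqr_le; rewrite ?covXX_ge0 ?sqr_ge0 //.
  by apply: sumr_ge0 => y _; rewrite mulr_ge0 ?sqr_ge0 ?cmod_ge0.
have := @weighted_cumulants_le (fun y => cmod (PhiW mu phi x (tup y))) (fun=> cmod_ge0 _).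
move=> /le_trans; apply; apply: ler_wpM2l; first exact: covXX_ge0.
have q12 : (2 = 1 \/ 2 = 2)%N by right.
(* This bound serves twice: for the rows of the kernel, and at [x] for the weight, which is itself a
   row. *)
have row := fun y => sum_PhiW_le phi_mom starP nN q12 fin w0 zetaI y.
apply: hilbert_schmidt_test => // [u v|u v||u|u]; rewrite ?cmod_ge0 ?bound_ge0 //.
exact: (cmod_PhiWC phi_mom starP nN).
Qed.

End Box.

Lemma pow2_le_expR m : 2 ^+ m <= expR m%:R :> R.
Proof.
rewrite -[m%:R]mulr1 expRM_natl lerXn2r ?nnegrE ?expR_ge0 //.
by have := expR_ge1Dx (1 : R).
Qed.

Lemma poweR_half_le (S : \bar R) (b c : R) : (0 <= S)%E -> 0 <= c ->
  (S <= b%:E)%E -> b <= c ^+ 2 -> (poweR S 2^-1 <= c%:E)%E.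
Proof.
move=> S0 c0 Sb bc.
have -> : c%:E = poweR (c ^+ 2)%:E 2^-1.
  by rewrite poweR_EFin powR12_sqrt ?sqr_ge0 // sqrtr_sqr ger0_norm.
apply: gt0_ler_poweR => //; rewrite ?in_itv /= ?leey ?andbT //.
  by rewrite lee_fin sqr_ge0.
by apply: le_trans Sb _; rewrite lee_fin.
Qed.

End Main.

Theorem mainTheorem1 (d : measure_display) (T : measurableType d) (R : realType)
  (mu : probability T R) (Z : countType) (z0 : Z) (phi : Z -> crv T R)
  (p : R) (N : nat) (X : crv T R) :
  1 <= p -> (0 < N)%N ->
  closed_under_conj phi ->
  clustering_upto mu phi p (2 * N) ->
  L2 mu X ->
  forall n : nat, (0 < n <= N)%N ->
  (p = 1 ->
     let S := \esum_(x in [set: 'I_n -> Z])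
                ((cmod (cumulant mu (rvcons X (fun i => phi (x i))))) ^+ 2)%:E in
     (S < +oo)%E /\
     (poweR S 2^-1 <=
        (Num.sqrt (covXX mu X) * Mconst mu phi 1 (2 * n) ^+ n
           * expR n%:R * Num.sqrt ((2 * n)`!%:R))%:E)%E)
  /\
  (p = 2 ->
     let S := fun x' : 'I_n -> Z =>
       \esum_(x in [set: 'I_n -> Z])
          (cmod (PhiW mu phi x' x)
           * (cmod (cumulant mu (rvcons X (fun i => phi (x i))))) ^+ 2)%:E in
     (forall x' : 'I_n -> Z, (S x' < +oo)%E) /\
     (ereal_sup (range (fun x' : 'I_n -> Z => poweR (S x') 2^-1)) <=
        (Num.sqrt (covXX mu X) * Mconst mu phi 2 (2 * n) ^+ (2 * n)
           * expR (2 * n)%:R * (2 * n)`!%:R)%:E)%E).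
Proof.
move=> _ _ phi_conj [phi_mom fin] X2 n /andP[n0 nN].
have V0 : 0 <= covXX mu X by exact: covXX_ge0.
split=> pE S; rewrite pE in fin.
  have Sb : (S <= (covXX mu X * ((2 * n)`!%:R * 2 ^+ (2 * n) *
      Mconst mu phi 1 (2 * n) ^+ (2 * n)))%:E)%E.
    apply: (esum_box_le z0) => [y|W w0 zeta zetaI]; first exact: sqr_ge0.
    exact: (sum_sqr_cumulant_le phi_mom phi_conj n0 nN X2 w0 zetaI fin).
  split; first exact: le_lt_trans Sb (ltry _).
  apply: poweR_half_le Sb _.
  - by apply: esum_ge0 => y _; rewrite lee_fin sqr_ge0.
  - by rewrite !mulr_ge0 ?sqrtr_ge0 ?exprn_ge0 ?expR_ge0 ?Mconst_ge0.
  (* The squared target contains (e^n)^2 and (M^n)^2, so the powers 2n of 2 and M are read as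
     squares of n-th powers. *)
  rewrite (mulnC 2 n) (exprM _ n 2) (exprM _ n 2).
  set f := (_`!)%:R; set a := Mconst _ _ _ _ ^+ n.
  have -> : (Num.sqrt (covXX mu X) * a * expR n%:R * Num.sqrt f) ^+ 2 =
      covXX mu X * (f * expR n%:R ^+ 2 * a ^+ 2).
    by rewrite !exprMn !sqr_sqrtr ?ler0n //; ring.
  apply: ler_wpM2l => //; apply: ler_wpM2r; first exact: sqr_ge0.
  apply: ler_wpM2l; first exact: ler0n.
  by apply: lerXn2r; rewrite ?nnegrE ?exprn_ge0 ?expR_ge0 ?pow2_le_expR.
have Sb x : (S x <= (covXX mu X * ((2 * n)`!%:R * 2 ^+ (2 * n) *
    Mconst mu phi 2 (2 * n) ^+ (2 * n)) ^+ 2)%:E)%E.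
  apply: (esum_box_le z0) => [y|W w0 zeta zetaI]; first by rewrite mulr_ge0 ?sqr_ge0 ?cmod_ge0.
  exact: (sum_weighted_sqr_cumulant_le phi_mom phi_conj n0 nN X2 w0 zetaI x fin).
split=> [x|]; first exact: le_lt_trans (Sb x) (ltry _).
apply: ge_ereal_sup => _ [x _ <-].
apply: poweR_half_le (Sb x) _.
- by apply: esum_ge0 => y _; rewrite lee_fin mulr_ge0 ?sqr_ge0 ?cmod_ge0.
- by rewrite !mulr_ge0 ?sqrtr_ge0 ?exprn_ge0 ?expR_ge0 ?Mconst_ge0 ?ler0n.
have M0 := Mconst_ge0 mu phi 2 (2 * n).
set f := (_`!)%:R; set a := Mconst _ _ _ _ ^+ _.
(* Here the row bound enters squared, so the target keeps e^(2n) and (2n)! without a root, and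
   2^(2n) is compared with e^(2n) directly. *)
have -> : (Num.sqrt (covXX mu X) * a * expR (2 * n)%:R * f) ^+ 2 =
    covXX mu X * (f * expR (2 * n)%:R * a) ^+ 2.
  by rewrite !exprMn !sqr_sqrtr //; ring.
have a0 : 0 <= a by exact: exprn_ge0.
apply: ler_wpM2l => //; apply: lerXn2r.
- by rewrite nnegrE !mulr_ge0 ?exprn_ge0 ?ler0n.
- by rewrite nnegrE !mulr_ge0 ?expR_ge0 ?ler0n.
apply: ler_wpM2r => //; apply: ler_wpM2l; first exact: ler0n.
exact: pow2_le_expR.
Qed.
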